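(* Let $V$ be a finite-dimensional real vector space. A cone $C \subset V$ (that is, a closed pointed convex linear cone) satisfies the flat boundary intersections (FBI) property, i.e. for each $a \in \operatorname{int}(C)$ the affine span of $\partial C \cap \partial(a - C)$ has dimension $\dim(C) - 1$, if and only if $C$ is an ellipsoidal cone, i.e. some section of $C$ is an ellipsoid.
   Context: A convex linear cone in $V$ is a nonempty convex subset $C \subset V$ such that $a \in C$ and $\lambda \ge 0$ imply $\lambda a \in C$. It is pointed if there exists a hyperplane $H$ in $V$ such that $H \cap C = \{0\}$. ''Cone'' means closed pointed convex linear cone. For a convex subset $K \subset V$, $\operatorname{aff}(K)$ is its affine span, $\dim K$ is the dimension of $\operatorname{aff}(K)$, and $\operatorname{int}(K)$ and $\partial K$ denote the interior and boundary of $K$ relative to $\operatorname{aff}(K)$ under the subspace topology. For $a \in V$, $a - C = \{a - x : x \in C\}$. A section of $K$ is a $(\dim K - 1)$-dimensional intersection of $K$ with an affine hyperplane. A (solid) ellipsoid in $V$ is the image of the closed unit ball in some Euclidean vector space $E$ under an affine map $E \to V$. *)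

(* Defs.v *)
From HB Require Import structures.
From mathcomp Require Import all_boot all_order all_algebra.
From mathcomp Require Import all_classical all_reals all_analysis.

Set Implicit Arguments.
Unset Strict Implicit.
Unset Printing Implicit Defensive.

Import Order.TTheory GRing.Theory Num.Theory.
Import numFieldNormedType.Exports.

Local Open Scope classical_set_scope.
Local Open Scope ring_scope.

Definition coordinates (R : realType) (V : vectType R) (v : V) :
    'rV[R]_(\dim {:V}) :=
  \row_i coord (vbasis {:V}) i v.

(* [V] with its canonical topology, transported from R^n along a linear
   coordinate isomorphism; it does not depend on the chosen basis. *)
Definition fdtop (R : realType) (V : vectType R) : Type :=
  initial_topology (@coordinates R V).

HB.instance Definition _ (R : realType) (V : vectType R) :=
  Topological.copy (fdtop V) (initial_topology (@coordinates R V)).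

Section Cones.
Variables (R : realType) (V : vectType R).
Implicit Types (a : V) (A C H K S : set V) (W : {vspace V}).

Definition aff A : set V :=
  [set x | exists (n : nat) (c : 'I_n -> R) (y : 'I_n -> V),
    [/\ forall i, A (y i), \sum_i c i = 1 & x = \sum_i c i *: y i]].

Definition contains_differences A W : Prop :=
  forall x y, A x -> A y -> x - y \in W.

Definition is_direction A W : Prop :=
  contains_differences A W /\
  forall W', contains_differences A W' -> (W <= W')%VS.

Definition direction A : {vspace V} := xget 0%VS (is_direction A).

Lemma directionP A : is_direction A (direction A).
Proof.
suff [W0 PW0] : exists W, is_direction A W by
  exact: (@xgetPex _ 0%VS (is_direction A) (ex_intro _ W0 PW0)).
pose P n := `[< exists2 W, contains_differences A W & \dim W = n >].
have exP : exists n, P n.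
  by exists (\dim {:V}); apply/asboolP; exists fullv => // x y; rewrite memvf.
case: (ex_minnP exP) => n /asboolP[W cW dW] minW.
exists W; split=> // W' cW'.
have cI : contains_differences A (W :&: W')%VS.
  by move=> x y Ax Ay; rewrite memv_cap cW ?cW'.
have /eqP <- : (W :&: W')%VS == W; last exact: capvSr.
by rewrite eqEdim capvSl dW minW//; apply/asboolP; exists (W :&: W')%VS.
Qed.

(* The dimension of the affine span. The empty set gets dimension 0 (its
   direction is the zero subspace), not -1: a half-line [C] is an ellipsoidal
   cone, and it satisfies [FBI] below only with this convention, since the
   intersection of boundaries considered there is then empty. *)
Definition adim A : nat := \dim (direction (aff A)).

(* [subspace (aff K)] is a copy of [V] carrying the subspace topology on
   [aff K] and isolating all other points; the latter lie neither in the
   interior nor in the closure of [K], since [K] is contained in [aff K]. *)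
Definition relint K : set V :=
  @interior (subspace (aff K : set (fdtop V))) K.

Definition relbd K : set V :=
  @closure (subspace (aff K : set (fdtop V))) K `\` relint K.

Definition affine_hyperplane H : Prop :=
  exists (p : V) (W : {vspace V}),
    (\dim W).+1 = \dim {:V} /\ H = [set x | x - p \in W].

Definition convex_linear_cone C : Prop :=
  [/\ C !=set0, convex_set C &
      forall (a : V) (l : R), C a -> 0 <= l -> C (l *: a)].

Definition pointed C : Prop :=
  exists H, affine_hyperplane H /\ H `&` C = [set 0].

Definition cone C : Prop :=
  [/\ convex_linear_cone C, pointed C & closed (C : set (fdtop V))].

Definition reflection a C : set V := [set a - x | x in C].

(* Dimensions are compared with a successor rather than with [_.-1], which
   is truncated at 0. *)
Definition FBI C : Prop :=
  forall a, relint C a ->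
    (adim (relbd C `&` relbd (reflection a C))).+1 = adim C.

Definition is_section K S : Prop :=
  (adim S).+1 = adim K /\ exists H, affine_hyperplane H /\ S = K `&` H.

Definition unit_ball (E : vectType R) (dot : {dot E for idfun}) : set E :=
  [set x | Num.sqrt (dot x x) <= 1].

Definition ellipsoid S : Prop :=
  exists (E : vectType R) (dot : {dot E for idfun})
         (L : {linear E -> V}) (c : V),
    S = [set L x + c | x in unit_ball dot].

Definition ellipsoidal_cone C : Prop :=
  exists S, is_section C S /\ ellipsoid S.

End Cones.

(* Main.v *)
(* Let a be interior to C. In each plane through a, the cone is an angle, and it
   meets a - C in a parallelogram with corners 0 and a; the two other corners
   are the boundary points in question. Hence FBI at a says that a linear
   functional f_a with f_a(a) = 1 takes the value 1/2 at all these corners, that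
   is, that the section {f_a = 1} of C is symmetric about a, or again that the
   involution S_a(v) = 2 f_a(v) a - v preserves C.

   On a plane with coordinates (s, t) along its two boundary rays,
   f_a(v) = (s(v)/s(a) + t(v)/t(a)) / 2, so f_y(x) / f_x(y) is the ratio of the
   values of st at x and y. This ratio c(x, y) is a cocycle: some S_p maps x to
   sqrt(c(x, y)) y, so a product of three such involutions multiplies x by
   sqrt(c(x, y) c(y, z) c(z, x)); its determinant is 1 or -1, and an
   automorphism of C fixing an interior point has bounded powers, hence
   determinant 1 or -1 as well, so the factor is 1. Thus c(x, y) = F(x) / F(y),
   and F(x) f_x(y) = F(y) f_y(x) extends to a symmetric bilinear form that
   vanishes on the boundary of C. Its negative is positive definite on the
   kernel of f_e, and its unit ball is the section {f_e = 1}, up to scaling and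
   translation by e.

   Conversely, a cone over an ellipsoid is cut out by a quadratic form b that
   vanishes on its boundary, and then f_a = b(a, .) / b(a, a) is linear. *)
Require Import Defs.
From HB Require Import structures.
From mathcomp Require Import all_boot all_order all_algebra.
From mathcomp Require Import all_classical all_reals all_analysis.
From mathcomp Require Import perm ring lra.

Set Implicit Arguments.
Unset Strict Implicit.
Unset Printing Implicit Defensive.

Import Order.TTheory GRing.Theory Num.Theory.
Import numFieldNormedType.Exports.

Local Open Scope classical_set_scope.
Local Open Scope ring_scope.

(** * Vector identities checked coordinate by coordinate *)

Section Coordinates.
Variables (R : realType) (U : vectType R).
Implicit Types (u v : U) (i : 'I_(\dim {:U})).

Definition coordf i v : R := coord (vbasis {:U}) i v.

Lemma coordf_inj u v : (forall i, coordf i u = coordf i v) -> u = v.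
Proof.
move=> uv; rewrite (coord_vbasis (memvf u)) (coord_vbasis (memvf v)).
by apply: eq_bigr => i _; congr (_ *: _); exact: uv.
Qed.

Lemma coordfD i u v : coordf i (u + v) = coordf i u + coordf i v.
Proof. exact: linearD. Qed.

Lemma coordfN i u : coordf i (- u) = - coordf i u.
Proof. exact: linearN. Qed.

Lemma coordfZ i k u : coordf i (k *: u) = k * coordf i u.
Proof. exact: linearZ. Qed.

Lemma coordf0 i : coordf i 0 = 0.
Proof. exact: linear0. Qed.

End Coordinates.

(* [ring] and [field] do not handle vectors, but they do handle coordinates. *)
Ltac to_coordinates :=
  apply: coordf_inj => ?; rewrite ?(coordfD, coordfN, coordfZ, coordf0).

(** * The gauge of an order unit *)

Section GaugeDefinitions.
Variables (R : realType) (U : vectType R) (C : set U).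

(** [cone_archimedean] is the only trace of closedness kept here, so that the theory of the gauge is
    free of topology. *)
Record salient_cone : Prop := SalientCone {
  coneD : forall u v, C u -> C v -> C (u + v);
  coneZ : forall l v, 0 <= l -> C v -> C (l *: v);
  cone_salient : forall v, C v -> C (- v) -> v = 0;
  cone_archimedean : forall u v, (forall e, 0 < e -> C (v + e *: u)) -> C v;
  cone_nontrivial : exists v : U, v != 0
}.

(** The algebraic interior; [relint_aint] identifies it with the relative interior of the cone. *)
Definition aint x : Prop := forall v, exists2 e, 0 < e & C (x + e *: v).

(* The least [l] with [v <= l *: x] in the order of [C]; the largest [l] with
   [l *: x <= v] is [- gauge x (- v)]. *)
Definition gauge x v : R := inf [set l | C (l *: x - v)].

(* [v + t *: x] lies in [C] for [gauge x (- v) <= t] and in [- C] for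
   [t <= - gauge x v]; [- mid x v] is the midpoint of these two parameters. *)
Definition mid x v : R := (gauge x v - gauge x (- v)) / 2.

End GaugeDefinitions.

Section Gauge.
Variables (R : realType) (U : vectType R) (C : set U).
Hypothesis HC : salient_cone C.
Let CD := coneD HC.
Let CZ := coneZ HC.
Let salient := cone_salient HC.

Lemma aint_mem x : aint C x -> C x.
Proof. by move=> /(_ 0)[e _]; rewrite scaler0 addr0. Qed.

Lemma aintD x y : aint C x -> C y -> aint C (x + y).
Proof.
move=> xi Cy v; have [e e0 Ce] := xi v; exists e => //.
by rewrite addrAC; exact: CD.
Qed.

Lemma aintZ l x : 0 < l -> aint C x -> aint C (l *: x).
Proof.
move=> l0 xi v; have [e e0 Ce] := xi v; exists (l * e); first exact: mulr_gt0.
by rewrite -scalerA -scalerDr; apply: CZ => //; exact: ltW.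
Qed.

(** Otherwise [x = 0] by salience, and an interior origin makes [C] the whole nonzero space, which
    is not salient. *)
Lemma aint_opp x : aint C x -> ~ C (- x).
Proof.
move=> xi Cx; have x0 := salient (aint_mem xi) Cx.
case: (cone_nontrivial HC) => v /eqP; apply.
have CU u : C u.
  have [e e0] := xi u; rewrite x0 add0r => /(CZ (ltW _)) - /(_ e^-1).
  by rewrite invr_gt0 scalerA mulVf ?scale1r ?gt_eqF//; exact.
by apply: salient; exact: CU.
Qed.

(** If [x - e *: v] is in [C], then [e^-1] is in the set. If [x + e *: v] is in [C], then [- e^-1]
    is a lower bound: adding [e^-1 *: (x + e *: v)] to [l *: x - v] leaves a multiple of [x], which
    cannot be negative. *)
Lemma gauge_has_inf x v : aint C x -> has_inf [set l | C (l *: x - v)].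
Proof.
move=> xi; split.
  have [e e0 Ce] := xi (- v); exists e^-1 => /=.
  have -> : e^-1 *: x - v = e^-1 *: (x + e *: - v).
    by to_coordinates; field; exact: lt0r_neq0.
  by apply: CZ => //; rewrite invr_ge0 ltW.
have [e e0 Ce] := xi v; exists (- e^-1) => l /= Cl.
rewrite leNgt; apply/negP => le; apply: (aint_opp xi).
have le1 : e * l < -1 by rewrite -(ltr_pM2l e0) mulrN mulfV ?gt_eqF in le.
have -> : - x = (- (l + e^-1))^-1 *: ((l *: x - v) + e^-1 *: (x + e *: v)).
  by to_coordinates; field; rewrite lt0r_neq0//=; apply/eqP => ?; lra.
apply: CZ; first by rewrite invr_ge0; lra.
by apply: CD => //; apply: CZ => //; rewrite invr_ge0 ltW.
Qed.

(** The Archimedean property makes the infimum attained; membership in [C] along the direction [x]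
    becomes an inequality. *)
Lemma gaugeP x v l : aint C x -> C (l *: x - v) <-> gauge C x v <= l.
Proof.
move=> xi; have infv := gauge_has_inf v xi.
split=> [Cl|gl]; first exact: ge_inf (proj2 infv) _ Cl.
apply: (cone_archimedean HC (u := x)) => e e0.
have [k Ck kl] := inf_adherent e0 infv.
have -> : l *: x - v + e *: x = (l + e - k) *: x + (k *: x - v).
  by to_coordinates; ring.
apply: CD => //; apply: CZ; last exact: aint_mem.
by rewrite /gauge in gl; lra.
Qed.

Lemma gaugeN_le x v l : aint C x -> C (v - l *: x) <-> gauge C x (- v) <= - l.
Proof. by move=> xi; rewrite -gaugeP// scaleNr opprK addrC. Qed.

Lemma gauge_eq x v g : aint C x ->
  (forall l, C (l *: x - v) <-> g <= l) -> gauge C x v = g.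
Proof.
move=> xi gP; apply/eqP; rewrite eq_le; apply/andP; split.
  by apply/gaugeP => //; exact/gP.
by apply/gP/gaugeP.
Qed.

Lemma mem_gauge x v : aint C x -> C v <-> gauge C x (- v) <= 0.
Proof. by move=> xi; rewrite -gaugeP// scale0r add0r opprK. Qed.

Lemma gauge_shift x v k : aint C x -> gauge C x (v + k *: x) = gauge C x v + k.
Proof.
move=> xi; apply: gauge_eq => // l; rewrite -lerBrDr -gaugeP//.
by have -> : l *: x - (v + k *: x) = (l - k) *: x - v by to_coordinates; ring.
Qed.

Lemma gauge_width_ge0 x v : aint C x -> 0 <= gauge C x v + gauge C x (- v).
Proof.
move=> xi; rewrite leNgt; apply/negP => w0; apply: (aint_opp xi).
have C1 : C (gauge C x v *: x - v) by apply/gaugeP.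
have C2 : C (gauge C x (- v) *: x - - v) by apply/gaugeP.
have -> : - x = (- (gauge C x v + gauge C x (- v)))^-1 *:
    ((gauge C x v *: x - v) + (gauge C x (- v) *: x - - v)).
  by to_coordinates; field; apply/eqP => ?; lra.
by apply: CZ; [rewrite invr_ge0; lra|exact: CD].
Qed.

Lemma gauge_width_eq0 x v : aint C x ->
  gauge C x v + gauge C x (- v) = 0 -> v = gauge C x v *: x.
Proof.
move=> xi w0; apply/eqP; rewrite -subr_eq0 -oppr_eq0 opprB; apply/eqP.
apply: salient; first exact/gaugeP.
rewrite opprB.
have -> : v - gauge C x v *: x = (gauge C x (- v)) *: x - - v.
  have -> : gauge C x (- v) = - gauge C x v by lra.
  by to_coordinates; ring.
exact/gaugeP.
Qed.

Lemma gauge_boundary x v : aint C x -> ~ aint C (gauge C x v *: x - v).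
Proof.
move=> xi /(_ (- x))[e e0].
have -> : gauge C x v *: x - v + e *: - x = (gauge C x v - e) *: x - v.
  by to_coordinates; ring.
by rewrite gaugeP//; lra.
Qed.

Lemma gauge_self x : aint C x -> gauge C x x = 1.
Proof.
move=> xi; apply: gauge_eq => // l.
have -> : l *: x - x = (l - 1) *: x by to_coordinates; ring.
split=> [Cl|l1]; last by apply: CZ (aint_mem xi); lra.
rewrite leNgt; apply/negP => l1; apply: (aint_opp xi).
have -> : - x = (1 - l)^-1 *: ((l - 1) *: x) by to_coordinates; field;
  apply/eqP => ?; lra.
by apply: CZ => //; rewrite invr_ge0; lra.
Qed.

Lemma gauge0 x : aint C x -> gauge C x 0 = 0.
Proof.
move=> xi; have := gauge_shift x (-1) xi.
by rewrite gauge_self// scaleN1r subrr => ->; rewrite subrr.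
Qed.

Lemma gauge_selfN x : aint C x -> gauge C x (- x) = -1.
Proof.
move=> xi; have := gauge_shift (- x) 1 xi.
by rewrite scale1r addNr gauge0// => /eqP; rewrite eq_sym addr_eq0 => /eqP.
Qed.

Lemma midE x v : mid C x v = (gauge C x v - gauge C x (- v)) / 2.
Proof. by []. Qed.

Lemma mid_self x : aint C x -> mid C x x = 1.
Proof. by move=> xi; rewrite /mid gauge_self// gauge_selfN//; field. Qed.

End Gauge.

(** * Linear maps, inner products and orthogonal projection *)

Lemma linear_hom (R : realType) (U V : vectType R) (g : U -> V) :
  linear g -> exists T : 'Hom(U, V), T =1 g.
Proof.
move=> lg; pose G : {linear U -> V} := HB.pack g (GRing.isLinear.Build _ _ _ _
  g lg).
by exists (linfun G) => v; rewrite lfunE.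
Qed.

Lemma dot_of_form (R : realType) (E : vectType R) (b : E -> E -> R) :
  (forall u, scalar (b u)) -> (forall u v, b u v = b v u) ->
  (forall u, u != 0 -> 0 < b u u) ->
  exists d : {dot E for idfun}, forall u v, d u v = b u v.
Proof.
move=> bl bs bp.
have bl1 v : linear_for *%R (b^~ v).
  by move=> k u w; rewrite /= bs bl !(bs v).
have bl2 u : linear_for (idfun \; *%R) (b u) by move=> k v w; rewrite bl.
have bh x y : b x y = (-1) ^+ false * idfun (b y x) by rewrite expr0 mul1r bs.
pose d : {dot E for idfun} := HB.pack b
  (@bilinear_isBilinear.Build R E E R *%R (idfun \; *%R) b (bl1, bl2))
  (@isHermitianSesquilinear.Build R E false idfun b bh)
  (@isDotProduct.Build R E b bp).
by exists d.
Qed.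

Section OrthogonalProjection.
Variables (R : realType) (E : vectType R) (dot : {dot E for idfun}).

Lemma dotC x y : dot x y = dot y x.
Proof. by rewrite hermC expr0 mul1r. Qed.

Lemma dotZZ k x : dot (k *: x) (k *: x) = k ^+ 2 * dot x x.
Proof. by rewrite linearZ /= dotC linearZ /= mulrA -expr2. Qed.

Lemma dotDD x y : dot (x + y) (x + y) = dot x x + 2 * dot x y + dot y y.
Proof.
have dotDr u v w : dot u (v + w) = dot u v + dot u w by rewrite linearD.
by rewrite dotDr !(dotC (x + y)) !dotDr (dotC y x); ring.
Qed.

Lemma dot_ge0 x : 0 <= dot x x.
Proof.
have [->|/neq0_dnorm_gt0 x0] := eqVneq x 0; first by rewrite linear0.
exact/ltW/x0.
Qed.

(** Positive definiteness makes the intersection trivial. For the sum, [orthov dot K] contains the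
    kernel of [Phi], the pairing with a basis of [K], whose rank is at most [\dim K]. *)
Lemma orthov_compl (K : {vspace E}) :
  (orthov dot K :&: K = 0)%VS /\ (orthov dot K + K = fullv)%VS.
Proof.
have cap0 : (orthov dot K :&: K = 0)%VS.
  apply/eqP; rewrite -subv0; apply/subvP => u; rewrite memv_cap memv0.
  move=> /andP[/mem_orthovP uK Ku]; apply: contraT => u0.
  by have := neq0_dnorm_gt0 (s := dot) _ u0; rewrite uK// ltxx.
split=> //; apply/eqP; rewrite eqEdim subvf /= dimv_disjoint_sum//.
have lPhi : linear (fun x : E => \row_(j < \dim K) dot x (vbasis K)`_j).
  move=> k x y; apply/rowP => j; rewrite !mxE !(dotC _ (vbasis K)`_j).
  by rewrite linearD linearZ.
have [Phi PhiE] := linear_hom lPhi.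
have kerPhi : (lker Phi <= orthov dot K)%VS.
  apply/subvP => x; rewrite memv_ker PhiE => /eqP /rowP x0.
  apply/mem_orthovP => v vK; rewrite (coord_vbasis vK) linear_sum big1// => j _.
  by rewrite linearZ /=; have := x0 j; rewrite !mxE => ->; rewrite mulr0.
rewrite -(limg_ker_dim Phi fullv) capfv leq_add ?dimvS//.
by rewrite (leq_trans (dimvS (subvf _)))// dimvf /dim /= mul1n.
Qed.

Lemma orthogonal_projection (K : {vspace E}) : exists P : 'End(E),
  [/\ forall x, x - P x \in K & forall x k, k \in K -> dot (P x) k = 0].
Proof.
have [cap0 sumK] := orthov_compl K.
exists (daddv_pi (orthov dot K) K); split=> x; last first.
  by move=> k kK; apply/mem_orthovP: kK; exact: memv_pi.
have := daddv_pi_add cap0 (_ : x \in _); rewrite sumK memvf => /(_ isT) E1.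
by rewrite -{1}E1 addrC addKr memv_pi.
Qed.

End OrthogonalProjection.

(** * Determinants of endomorphisms with bounded powers *)

Section PowerBoundedDeterminant.
Variable R : realType.

Lemma det_bound n (A : 'M[R]_n) (B : R) :
  (forall i j, `|A i j| <= B) -> `|\det A| <= n`!%:R * B ^+ n.
Proof.
move=> AB; rewrite /determinant (le_trans (ler_norm_sum _ _ _))//.
have -> : n`!%:R * B ^+ n = \sum_(s : 'S_n) B ^+ n.
  by rewrite sumr_const card_Sn mulr_natl.
apply: ler_sum => s _; rewrite normrM normrX normrN1 expr1n mul1r normr_prod.
have -> : B ^+ n = \prod_(i < n) B by rewrite prodr_const card_ord.
by apply: ler_prod => i _; rewrite normr_ge0 AB.
Qed.

(** By Bernoulli's inequality the powers of [a > 1] outgrow every bound. *)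
Lemma le1_of_bounded_powers (a D : R) : (forall k, a ^+ k <= D) -> a <= 1.
Proof.
move=> aD; rewrite leNgt; apply/negP => a1.
have bernoulli k : 1 + k%:R * (a - 1) <= a ^+ k.
  elim: k => [|k IH]; first by rewrite mul0r addr0 expr0.
  rewrite exprS -natr1; have k0 : 0 <= k%:R :> R by [].
  have : a * (1 + k%:R * (a - 1)) <= a * a ^+ k by rewrite ler_pM2l//; lra.
  by apply: le_trans; have := mulr_ge0 k0 (sqr_ge0 (a - 1)); lra.
have [k kD] : exists k : nat, D / (a - 1) < k%:R.
  by exists (Num.truncn `|D / (a - 1)|).+1;
    rewrite (le_lt_trans (ler_norm _))// truncnS_gt.
have := le_trans (bernoulli k) (aD k).
have : D < k%:R * (a - 1) by rewrite -ltr_pdivrMr//; lra.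
lra.
Qed.

Lemma det_le1_of_bounded_powers n (A : 'M[R]_n) (B : R) :
  (forall k i j, `|(iter k (mulmx A) 1%:M) i j| <= B) -> `|\det A| <= 1.
Proof.
move=> AB; apply: (@le1_of_bounded_powers _ (n`!%:R * B ^+ n)) => k.
have -> : `|\det A| ^+ k = `|\det (iter k (mulmx A) 1%:M)|.
  rewrite -normrX; congr `|_|.
  by elim: k => [|k IH]; rewrite ?expr0 ?det1//= det_mulmx exprS IH.
exact: det_bound.
Qed.

End PowerBoundedDeterminant.

Section EndDeterminant.
Import passmx.
Variables (R : realType) (U : vectType R).

Definition endo_mx (T : 'End(U)) := mxof (vbasis {:U}) (vbasis {:U}) T.

Lemma endo_mxE T i j : endo_mx T i j = coordf j (T (vbasis {:U})`_i).
Proof. by rewrite mxE /= vecof_delta mxE. Qed.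

Lemma endo_mx_comp S T : endo_mx (S \o T)%VF = endo_mx T *m endo_mx S.
Proof. exact: mxof_comp (vbasisP _) _ _. Qed.

Lemma endo_mx1 : endo_mx \1 = 1%:M.
Proof. by rewrite /endo_mx mxof1// (basis_free (vbasisP _)). Qed.

Lemma endo_mxZ k T : endo_mx (k *: T) = k *: endo_mx T.
Proof. by rewrite /endo_mx linearZ. Qed.

Lemma det_endo_le1 (T : 'End(U)) :
  (forall u i, exists B, forall k, `|coordf i (iter k T u)| <= B) ->
  `|\det (endo_mx T)| <= 1.
Proof.
move=> TB.
pose B := fun i j : 'I_(\dim {:U}) => sval (cid (TB (vbasis {:U})`_i j)).
apply: (@det_le1_of_bounded_powers _ _ _ (\sum_i \sum_j `|B i j|)) => k i j.
have -> : iter k (mulmx (endo_mx T)) 1%:M =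
    endo_mx (iter k (fun S => S \o T)%VF \1%VF).
  by elim: k => [|k IH]; rewrite ?endo_mx1//= IH endo_mx_comp.
rewrite endo_mxE.
have -> w : iter k (fun S => S \o T)%VF \1%VF w = iter k T w.
  elim: k w => [|k IH] w; first by rewrite id_lfunE.
  by rewrite iterS comp_lfunE IH -iterSr.
apply: (le_trans (svalP (cid (TB _ j)) k)); apply: (le_trans (ler_norm _)).
rewrite (bigD1 i)//= (bigD1 j)//= -addrA lerDl.
by rewrite addr_ge0 ?sumr_ge0// => i' _; rewrite sumr_ge0.
Qed.

End EndDeterminant.

(** * Reflections preserving the cone *)

Section Reflections.
Variables (R : realType) (U : vectType R) (C : set U).
Hypothesis HC : salient_cone C.
Hypothesis mid_linear : forall x, aint C x -> scalar (mid C x).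

Local Notation gauge := (gauge C).
Local Notation mid := (mid C).
Local Notation aint := (aint C).

(* When [mid x] is linear, this is the linear extension of the point reflection
   through [x] of the section [mid x = 1] of [C]. *)
Definition refl x v := (2 * mid x v) *: x - v.

Lemma midD x u v : aint x -> mid x (u + v) = mid x u + mid x v.
Proof. by move=> xi; rewrite -[u]scale1r mid_linear// mul1r scale1r. Qed.

Lemma midZ x k u : aint x -> mid x (k *: u) = k * mid x u.
Proof.
move=> xi; have mid0 : mid x 0 = 0 by rewrite /mid oppr0 subrr mul0r.
by rewrite -[k *: u]addr0 mid_linear// mid0 addr0.
Qed.

Lemma midN x u : aint x -> mid x (- u) = - mid x u.
Proof. by move=> xi; rewrite -scaleN1r midZ// mulN1r. Qed.

Lemma refl_linear x : aint x -> linear (refl x).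
Proof.
by move=> xi k u v; rewrite /refl midD// midZ//; to_coordinates; ring.
Qed.

(** The image is a sum of two elements of [C]: [gauge x v *: x - v], and a multiple of [x] whose
    coefficient is nonnegative because [v] is in [C]. *)
Lemma refl_mem x v : aint x -> C v -> C (refl x v).
Proof.
move=> xi Cv.
have -> : refl x v = (gauge x v *: x - v) + (- gauge x (- v)) *: x.
  by rewrite /refl /mid; to_coordinates; field.
apply: (coneD HC); first exact/gaugeP.
apply: (coneZ HC); last exact: aint_mem.
by rewrite oppr_ge0; exact/(mem_gauge HC).
Qed.

Lemma reflK x : aint x -> involutive (refl x).
Proof.
move=> xi v; rewrite /refl midD// midN// midZ// (mid_self HC xi).
by to_coordinates; ring.
Qed.

Lemma gauge_gt0 x y : aint x -> aint y -> 0 < gauge x y.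
Proof.
move=> xi yi; have [e e0] := yi (- x); rewrite scalerN (gaugeN_le HC) // => ge.
by have := gauge_width_ge0 HC y xi; lra.
Qed.

Lemma coneZP l v : 0 < l -> C (l *: v) <-> C v.
Proof.
move=> l0; split=> [Cl|]; last exact/(coneZ HC)/ltW.
rewrite -[v]scale1r -(mulVf (lt0r_neq0 l0)) -scalerA.
by apply: (coneZ HC) Cl; rewrite invr_ge0 ltW.
Qed.

(** For [l < 0], dividing [l *: y + x] by [- l] turns its membership in [C] into
    [gauge x y <= (- l)^-1]. *)
Lemma gaugeN x y : aint x -> aint y -> gauge y (- x) = - (gauge x y)^-1.
Proof.
move=> xi yi; have A0 := gauge_gt0 xi yi.
apply: (gauge_eq HC) => // l; rewrite opprK.
have [l0|l0] := leP 0 l.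
  split=> _; last first.
    by apply: (coneD HC (coneZ HC l0 (aint_mem yi)) (aint_mem xi)).
  by rewrite (le_trans _ l0)// oppr_le0 invr_ge0 ltW.
have -> : l *: y + x = (- l) *: ((- l)^-1 *: x - y).
  by to_coordinates; field; apply/eqP => ?; lra.
have Nl0 : 0 < - l by lra.
by rewrite coneZP// (gaugeP HC)// invf_pge// [X in _ <-> is_true X]lerNl.
Qed.

(* With [l] this factor, [p := x + l *: y] satisfies [mid p x = 1 / 2], so the
   reflection at [p] maps [x] to [p - x]. In coordinates along the boundary rays
   of the plane of [x] and [y], the condition on [l] reads
   [x1 / (x1 + l y1) + x2 / (x2 + l y2) = 1], so [l^2 = x1 x2 / (y1 y2)]. *)
Lemma refl_exchange x y : aint x -> aint y ->
  exists p, aint p /\ refl p x = Num.sqrt (gauge y x / gauge x y) *: y.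
Proof.
move=> xi yi; have A0 := gauge_gt0 xi yi; have B0 := gauge_gt0 yi xi.
set A := gauge x y in A0 *; set B := gauge y x in B0 *.
set l := Num.sqrt _.
have l0 : 0 < l by rewrite sqrtr_gt0 divr_gt0.
have l2 : l ^+ 2 * A = B.
  by rewrite sqr_sqrtr ?divr_ge0 ?ltW// mulfVK// gt_eqF.
have pi : aint (x + l *: y) by apply: (aintD HC) xi _;
  exact: (coneZ HC (ltW l0) (aint_mem yi)).
exists (x + l *: y); split => //.
suff m : mid (x + l *: y) x = 1 / 2.
  by rewrite /refl m; to_coordinates; field.
(* Membership is automatic for [k >= 1]; for [k < 1], dividing by [1 - k] reduces it to a bound on
   [gauge y x]. The second gauge is found in the same way. *)
have g1 : gauge (x + l *: y) x = B / (l + B).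
  apply: (gauge_eq HC) => // k; rewrite ler_pdivrMr ?addr_gt0//.
  have [k1|k1] := leP 1 k.
    split=> _; first by nra.
    have -> : k *: (x + l *: y) - x = (k - 1) *: x + (k * l) *: y
      by to_coordinates; ring.
    by apply: (coneD HC); apply: (coneZ HC); try exact: aint_mem; nra.
  have -> : k *: (x + l *: y) - x = (1 - k) *: ((k * l / (1 - k)) *: y - x).
    by to_coordinates; field; apply/eqP => ?; lra.
  rewrite coneZP ?subr_gt0// (gaugeP HC)// ler_pdivlMr ?subr_gt0// -/B.
  by split=> ?; lra.
have g2 : gauge (x + l *: y) (- x) = - (1 + l * A)^-1.
  apply: (gauge_eq HC) => // k; rewrite opprK.
  have lA : 0 < 1 + l * A by nra.
  have [k0|k0] := leP 0 k.
    split=> _; last by apply: (coneD HC (coneZ HC k0 (aint_mem pi)) (aint_mem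
      xi)).
    by rewrite (le_trans _ k0)// oppr_le0 invr_ge0 ltW.
  have kl : 0 < - k * l by nra.
  have -> : k *: (x + l *: y) + x = (- k * l) *: (((1 + k) / (- k * l)) *: x -
    y).
    to_coordinates; field; rewrite lt0r_neq0//=; apply/eqP => ?; lra.
  rewrite coneZP// (gaugeP HC)// ler_pdivlMr// -/A.
  by rewrite lerNl -div1r ler_pdivlMr//; split=> ?; lra.
rewrite /mid g1 g2 -l2; field.
by apply/andP; split; apply/eqP => ?; nra.
Qed.

End Reflections.

(** * The cocycle identity and the invariant bilinear form *)

Section Cocycle.
Variables (R : realType) (U : vectType R) (C : set U).
Hypothesis HC : salient_cone C.
Hypothesis mid_linear : forall x, aint C x -> scalar (mid C x).
Hypothesis interval_bounded : forall x i, exists K,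
  forall v, C (x - v) -> C (x + v) -> `|coordf i v| <= K.

Local Notation gauge := (gauge C).
Local Notation mid := (mid C).
Local Notation aint := (aint C).
Local Notation refl := (refl C).

(** Since [T] fixes [x] and preserves [C], it preserves the order interval from [- N *: x] to
    [N *: x]. All iterates of [u] stay there, hence are bounded. *)
Lemma det_fix_aint_le1 x (T : 'End(U)) : aint x -> T x = x ->
  (forall v, C v -> C (T v)) -> `|\det (endo_mx T)| <= 1.
Proof.
move=> xi Tx TC; apply: det_endo_le1 => u i.
pose N := Num.max (gauge x u) (gauge x (- u)).
have [K xK] := interval_bounded (N *: x) i; exists K => k; apply: xK.
  have -> : N *: x - iter k T u = iter k T (N *: x - u).
    elim: k => // k IH; by rewrite !iterS -IH linearB linearZ/= Tx.
  by elim: k => [|k /TC//]; apply/(gaugeP HC) => //; rewrite le_max lexx.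
have -> : N *: x + iter k T u = iter k T (N *: x + u).
  elim: k => // k IH; by rewrite !iterS -IH linearD linearZ/= Tx.
elim: k => [|k /TC//].
have -> : N *: x + u = N *: x - - u by rewrite opprK.
by apply/(gaugeP HC) => //; rewrite le_max lexx orbT.
Qed.

Lemma refl_endo p : aint p -> exists T : 'End(U),
  T =1 refl p /\ `|\det (endo_mx T)| = 1.
Proof.
move=> pi; have [T Tr] := linear_hom (refl_linear mid_linear pi).
exists T; split=> //.
have TT : (T \o T)%VF = \1%VF.
  by apply/lfunP => v; rewrite comp_lfunE id_lfunE !Tr (reflK HC mid_linear).
have := congr1 (fun S => \det (endo_mx S)) TT.
rewrite endo_mx_comp endo_mx1 det1 det_mulmx -expr2 => /(congr1 Num.norm).
rewrite normrX normr1 => /eqP; rewrite sqrp_eq1 ?normr_ge0//.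
by move=> /eqP.
Qed.

Local Notation ratio x y := (Num.sqrt (gauge y x / gauge x y)).

Lemma ratio_gt0 x y : aint x -> aint y -> 0 < ratio x y.
Proof. by move=> xi yi; rewrite sqrtr_gt0 divr_gt0// (gauge_gt0 HC). Qed.

Lemma ratio_inv x y : aint x -> aint y -> ratio x y * ratio y x = 1.
Proof.
move=> xi yi; have A := gauge_gt0 HC xi yi; have B := gauge_gt0 HC yi xi.
rewrite -sqrtrM ?divr_ge0 ?ltW// -[X in _ = X]sqrtr1; congr Num.sqrt.
by field; rewrite !gt_eqF.
Qed.

(* Three reflections carry the ray of [x] to those of [y], [z] and back to [x],
   multiplying [x] by the product of the three ratios. Divided by this factor,
   their composite fixes [x] and preserves [C], so its determinant is at most 1
   in absolute value, while reflections have determinant 1 or -1. *)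
Lemma cocycle_ge1 x y z : aint x -> aint y -> aint z ->
  1 <= ratio x y * ratio y z * ratio z x.
Proof.
move=> xi yi zi.
have [p [pi xy]] := refl_exchange HC xi yi.
have [q [qi yz]] := refl_exchange HC yi zi.
have [r [ri zx]] := refl_exchange HC zi xi.
have [P [Pr Pd]] := refl_endo pi.
have [Q [Qr Qd]] := refl_endo qi.
have [S [Sr Sd]] := refl_endo ri.
have a0 := ratio_gt0 xi yi; have b0 := ratio_gt0 yi zi;
  have c0 := ratio_gt0 zi xi.
set a := ratio x y in xy a0 *; set b := ratio y z in yz b0 *.
set c := ratio z x in zx c0 *.
have abc0 : 0 < a * b * c by rewrite !mulr_gt0.
pose T := ((a * b * c)^-1 *: (S \o (Q \o P)))%VF.
have Tx : T x = x.
  rewrite scale_lfunE !comp_lfunE Pr xy linearZ linearZ/= Qr yz !linearZ/= Sr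
    zx.
  by to_coordinates; field; rewrite !gt_eqF.
have TC v : C v -> C (T v).
  move=> Cv; rewrite scale_lfunE !comp_lfunE Pr Qr Sr.
  by apply: (coneZ HC); [rewrite invr_ge0 ltW|do !apply: (refl_mem HC)].
have := det_fix_aint_le1 xi Tx TC.
rewrite endo_mxZ !endo_mx_comp detZ !det_mulmx !normrM Pd Qd Sd !mulr1 normrX.
rewrite ger0_norm ?invr_ge0 ?(ltW abc0)//.
have d0 : (0 < \dim {:U})%N.
  rewrite lt0n dimv_eq0; apply/negP => /eqP U0.
  by case: (cone_nontrivial HC) => v /eqP; apply; apply/eqP;
    rewrite -memv0 -U0 memvf.
by rewrite expr_le1 ?invr_ge0 ?(ltW abc0)// invf_le1.
Qed.

(** Traversing the triangle backwards inverts every ratio, so [cocycle_ge1] for both orientations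
    gives product 1; squaring removes the roots. *)
Lemma cocycle x y z : aint x -> aint y -> aint z ->
  gauge y x * gauge z y * gauge x z = gauge x y * gauge y z * gauge z x.
Proof.
move=> xi yi zi.
have p1 : ratio x y * ratio y z * ratio z x = 1.
  have := cocycle_ge1 xi yi zi; have := cocycle_ge1 xi zi yi.
  have := ratio_inv xi yi; have := ratio_inv yi zi; have := ratio_inv zi xi.
  set a := ratio x y; set b := ratio y z; set c := ratio z x.
  set a' := ratio y x; set b' := ratio z y; set c' := ratio x z.
  move=> cc bb aa Q P; apply/eqP; rewrite eq_le P andbT.
  have <- : (a * b * c) * (c' * b' * a') = 1.
    have -> : (a * b * c) * (c' * b' * a') = (a * a') * (b * b') * (c * c')
      by ring.
    by rewrite aa bb cc !mulr1.
  by rewrite ler_peMr//; lra.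
have A := gauge_gt0 HC xi yi; have A' := gauge_gt0 HC yi xi.
have B := gauge_gt0 HC yi zi; have B' := gauge_gt0 HC zi yi.
have D := gauge_gt0 HC zi xi; have D' := gauge_gt0 HC xi zi.
have {p1} := congr1 (fun t => t ^+ 2) p1.
rewrite !exprMn expr1n !sqr_sqrtr ?divr_ge0 1?ltW// => p1.
rewrite -[RHS]mulr1 -p1.
by field; rewrite !gt_eqF.
Qed.

(** By [gaugeN], both sides are [(gauge x y * gauge y x + 1) / 2]. *)
Lemma mid_gauge_swap x y : aint x -> aint y ->
  mid y x * gauge x y = mid x y * gauge y x.
Proof.
move=> xi yi; rewrite /mid !(gaugeN HC)//.
have A := gauge_gt0 HC xi yi; have A' := gauge_gt0 HC yi xi.
by field; rewrite !gt_eqF.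
Qed.

Variable e : U.
Hypothesis ei : aint e.

(* By the cocycle identity [quad] is, up to a constant, independent of [e]; on
   each plane through the interior it is the product of the two linear forms
   vanishing on the boundary rays. *)
Definition quad x := gauge e x / gauge x e.

Lemma quad_mid_sym x y : aint x -> aint y -> quad x * mid x y =
  quad y * mid y x.
Proof.
move=> xi yi; have := mid_gauge_swap xi yi; have := cocycle xi yi ei.
have A := gauge_gt0 HC xi yi; have A' := gauge_gt0 HC yi xi.
have B := gauge_gt0 HC yi ei; have B' := gauge_gt0 HC ei yi.
have D := gauge_gt0 HC ei xi; have D' := gauge_gt0 HC xi ei.
move=> H1 H2; rewrite /quad.
apply: (mulfI (lt0r_neq0 A)).
have -> : gauge x y * (gauge e y / gauge y e * mid y x) =
  gauge e y / gauge y e * (mid y x * gauge x y) by ring.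
rewrite H2.
have -> : gauge e y / gauge y e * (mid x y * gauge y x) =
  (gauge y x * gauge e y * gauge x e) * mid x y / (gauge y e * gauge x e).
  by field; rewrite !gt_eqF.
by rewrite H1; field; rewrite !gt_eqF.
Qed.

Lemma quad_e : quad e = 1.
Proof. by rewrite /quad (gauge_self HC)// divr1. Qed.

(** The multiple [gauge e (- u)] of [e] brings [u] into [C]; one more [e] brings it into the
    interior. *)
Definition shift_coef u := gauge e (- u) + 1.

Lemma shift_aint u : aint (u + shift_coef u *: e).
Proof.
have -> : u + shift_coef u *: e = e + (gauge e (- u) *: e - - u).
  by rewrite /shift_coef; to_coordinates; ring.
by apply: (aintD HC) => //; apply/(gaugeP HC).
Qed.

(* [quad x * mid x y] is symmetric in interior [x] and [y] and linear in [y];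
   it is extended to all vectors by shifting the first one into the interior. *)
Definition bil u v :=
  quad (u + shift_coef u *: e) * mid (u + shift_coef u *: e) v - shift_coef u *
    mid e v.

(** By [quad_mid_sym] the shift moves into the linear argument of [mid v], where it cancels. *)
Lemma bil_aint u v : aint v -> bil u v = quad v * mid v u.
Proof.
move=> vi; rewrite /bil quad_mid_sym ?(midD mid_linear) ?(midZ mid_linear)//;
  last exact: shift_aint.
have := quad_mid_sym ei vi; rewrite quad_e mul1r => ->; ring.
Qed.

Lemma bil_scalar u : scalar (bil u).
Proof.
move=> k v w; rewrite /bil mid_linear; last exact: shift_aint.
by rewrite mid_linear//; ring.
Qed.

(** Once [v] is shifted into the interior, [bil_aint] produces the defining formula of [bil v u]. *)
Lemma bil_sym u v : bil u v = bil v u.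
Proof.
have -> : bil u v = bil u (v + shift_coef v *: e) - shift_coef v * bil u e.
  by rewrite [v + _]addrC bil_scalar; ring.
by rewrite (bil_aint _ (shift_aint v)) (bil_aint _ ei) quad_e mul1r.
Qed.

(** On an interior [w] this is the value of [quad w], by [gaugeN]; shifting by [e] gives the general
    case. On the kernel of [mid e] the two gauges agree, and the form is minus a square. *)
Lemma bil_diag v : bil v v = - (gauge e v * gauge e (- v)).
Proof.
have -> : bil v v = bil v (v + shift_coef v *: e) - shift_coef v * bil v e.
  by rewrite [v + _]addrC bil_scalar; ring.
have wi := shift_aint v; set w := v + _ in wi *.
have vE : v = w + (- shift_coef v) *: e by rewrite /w; to_coordinates; ring.
rewrite (bil_aint _ wi) (bil_aint _ ei) quad_e mul1r.
rewrite [in mid w v]vE (midD mid_linear)// (midZ mid_linear)// (mid_self HC)//.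
have := quad_mid_sym ei wi; rewrite quad_e mul1r => H.
have -> : quad w * (1 + - shift_coef v * mid w e) = quad w - shift_coef v *
  (quad w * mid w e) by ring.
rewrite -H.
have g1 : gauge e v = gauge e w - shift_coef v
  by rewrite [in LHS]vE (gauge_shift HC).
have g2 : gauge e (- v) = gauge e (- w) + shift_coef v.
  have -> : - v = - w + shift_coef v *: e by rewrite [in LHS]vE;
    to_coordinates; ring.
  by rewrite (gauge_shift HC).
have mv : mid e v = mid e w - shift_coef v.
  by rewrite /mid g1 g2; field.
rewrite mv g1 g2 /quad /mid (gaugeN HC)//; field.
by rewrite gt_eqF// (gauge_gt0 HC).
Qed.

End Cocycle.

(** * Boundary points and the midpoint functional *)

Section Boundary.
Variables (R : realType) (U : vectType R) (C : set U).
Hypothesis HC : salient_cone C.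

Local Notation gauge := (gauge C).
Local Notation mid := (mid C).
Local Notation aint := (aint C).

Definition abd : set U := [set z | C z /\ ~ aint z].

Lemma abd_gauge x z : aint x -> abd z -> gauge x (- z) = 0.
Proof.
move=> xi [Cz zi]; apply/eqP; rewrite eq_le; apply/andP; split.
  exact/(mem_gauge HC).
rewrite leNgt; apply/negP => g0; apply: zi.
have -> : z = (- gauge x (- z)) *: x + (gauge x (- z) *: x - - z).
  by to_coordinates; ring.
apply: (aintD HC); last exact/(gaugeP HC).
by apply: (aintZ HC) => //; lra.
Qed.

Lemma gauge_abd x v : aint x -> abd (gauge x v *: x - v).
Proof. by move=> xi; split; [exact/(gaugeP HC)|exact: gauge_boundary]. Qed.

Lemma abdZ l z : 0 < l -> abd z -> abd (l *: z).
Proof.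
move=> l0 [Cz zi]; split; first exact: (coneZ HC (ltW l0)).
move=> /(aintZ HC (l := l^-1)); rewrite invr_gt0 scalerA mulVf ?gt_eqF//
  scale1r.
by move=> /(_ l0).
Qed.

Definition abd_meet x : set U := [set z | abd z /\ abd (x - z)].

Lemma abd_meet_sym x z : abd_meet x z -> abd_meet x (x - z).
Proof. by move=> [z1 z2]; split; rewrite // opprB addrC subrK. Qed.

(** Here [gauge x (- z) = 0] and [gauge x z = 1]. All corners thus lie in one level set of [mid x],
    a hyperplane once [mid x] is linear. *)
Lemma mid_abd_meet x z : aint x -> abd_meet x z -> mid x z = 1 / 2.
Proof.
move=> xi [z1 z2]; have g1 := abd_gauge xi z1; have := abd_gauge xi z2.
have -> : - (x - z) = z + (-1) *: x by to_coordinates; ring.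
by rewrite (gauge_shift HC)// /mid g1 => g2; lra.
Qed.

(* [z] is a corner of the parallelogram cut out by [C] and [x - C] in the plane
   of [x] and [v], whose diagonals are [x] and [z - (x - z)]. *)
Lemma mid_residual x v : aint x -> v != gauge x v *: x ->
  exists z k, abd_meet x z /\ v - mid x v *: x = k *: (z - (x - z)).
Proof.
move=> xi vx.
have w0 : 0 < gauge x v + gauge x (- v).
  rewrite lt_neqAle (gauge_width_ge0 HC)// andbT eq_sym; apply: contra_neq vx.
  exact: (gauge_width_eq0 HC).
set w := gauge x v + _ in w0.
exists (w^-1 *: (gauge x v *: x - v)), (- (w / 2)); split.
  split; first by apply: abdZ; [rewrite invr_gt0|exact: gauge_abd].
  have -> : x - w^-1 *: (gauge x v *: x - v) = w^-1 *: (gauge x (- v) *: x - -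
    v).
    apply: (scalerI (lt0r_neq0 w0));
      rewrite scalerBr !scalerA mulfV ?gt_eqF// !scale1r.
    by rewrite /w; to_coordinates; ring.
  by apply: abdZ; [rewrite invr_gt0|exact: gauge_abd].
apply: (scalerI (lt0r_neq0 w0)); rewrite /mid.
have -> : gauge x v = w - gauge x (- v) by rewrite /w addrK.
by to_coordinates; field; rewrite gt_eqF.
Qed.

Lemma mid_multiple x v : aint x -> v = gauge x v *: x -> mid x v = gauge x v.
Proof.
move=> xi vE.
have -> : mid x v = gauge x v - (gauge x v + gauge x (- v)) / 2
  by rewrite /mid; field.
have -> : gauge x (- v) = - gauge x v.
  rewrite [in LHS]vE; have := gauge_shift HC 0 (- gauge x v) xi.
  by rewrite add0r scaleNr => ->; rewrite (gauge0 HC)// add0r.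
by rewrite subrr mul0r subr0.
Qed.

(** As [b] vanishes at [(z, z)] and [(a - z, a - z)], [b a z] is half of [b a a]. So [b a] kills the
    residual of [mid_residual], and [mid a v = b a v / b a a]. *)
Lemma mid_linear_of_form (b : U -> U -> R) :
  (forall u, scalar (b u)) -> (forall u v, b u v = b v u) ->
  (forall z, abd z -> b z z = 0) -> (forall a, aint a -> b a a != 0) ->
  forall a, aint a -> scalar (mid a).
Proof.
move=> bl bs b0 bi a ai.
have bD u v w : b u (v + w) = b u v + b u w
  by rewrite -[v]scale1r bl mul1r scale1r.
have b00 u : b u 0 = 0 by have := bl u (-1) 0 0;
  rewrite scaler0 addr0 mulN1r addNr.
have bZ u k v : b u (k *: v) = k * b u v by rewrite -[k *: v]addr0 bl b00 addr0.
have bN u v : b u (- v) = - b u v by rewrite -scaleN1r bZ mulN1r.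
suff E v : mid a v = b a v / b a a.
  by move=> k u v; rewrite !E bl mulrDl mulrA.
have [vE|/eqP] := eqVneq v (gauge a v *: a); last first.
  move=> /eqP /(mid_residual ai)[z [k [[z1 z2]]]].
  have -> : v - mid a v *: a = v + - (mid a v *: a) by [].
  move=> /(congr1 (b a)); rewrite !(bD, bN, bZ) => E.
  have Ez : b a z * 2 = b a a.
    have := b0 _ z2.
    by rewrite bD bN (bs _ a) (bs _ z) !bD !bN (bs z a) (b0 _ z1); lra.
  have k0 : b a z + - (b a a + - b a z) = 0 by lra.
  have -> : b a v = mid a v * b a a by rewrite k0 mulr0 in E; lra.
  by rewrite mulfK// bi.
have mE := mid_multiple ai vE.
by rewrite mE [in RHS]vE bZ mulfK ?bi.
Qed.

End Boundary.

(** * Affine spans and dimension *)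

Section AffineSpan.
Variables (R : realType) (V : vectType R).
Implicit Types (A C : set V) (W : {vspace V}).

(** A subspace of maximal dimension inside [A] exhausts [A], since adjoining an element of [A] does
    not leave [A]. *)
Lemma vspace_of_set A : A 0 -> (forall k u v, A u -> A v -> A (k *: u + v)) ->
  exists W, forall x, x \in W <-> A x.
Proof.
move=> A0 AD.
pose P n := `[< exists2 W : {vspace V}, (forall x, x \in W -> A x) &
  \dim W = n >].
have exP : exists n, P n.
  exists 0%N; apply/asboolP; exists 0%VS; last exact: dimv0.
  by move=> x; rewrite memv0 => /eqP ->.
have ubP n : P n -> (n <= \dim {:V})%N.
  by move=> /asboolP[W _ <-]; exact/dimvS/subvf.
case: (ex_maxnP exP ubP) => n /asboolP[W WA Wn] maxn.
exists W => x; split=> [/WA//|Ax].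
have : (\dim (W + <[x]>)%VS <= \dim W)%N.
  rewrite Wn; apply: maxn; apply/asboolP; exists (W + <[x]>)%VS => // y.
  move=> /memv_addP[w /WA Aw [_ /vlineP[k ->] ->]].
  by rewrite addrC; exact: AD.
move=> dW; have /eqP -> : W == (W + <[x]>)%VS by rewrite eqEdim addvSl.
by apply: (subvP (addvSr W <[x]>)); exact: memv_line.
Qed.

Lemma mem_aff A x : A x -> aff A x.
Proof.
move=> Ax; exists 1%N, (fun=> 1), (fun=> x); split=> //.
  by rewrite big_ord1.
by rewrite big_ord1 scale1r.
Qed.

(** Allows [adim] to be computed from the set itself instead of its affine span. *)
Lemma aff_differences A W :
  contains_differences (aff A) W <-> contains_differences A W.
Proof.
split=> AW x y; first by move=> /mem_aff Ax /mem_aff; exact: AW.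
have affW z z0 : A z0 -> aff A z -> z - z0 \in W.
  move=> Az0 [n [c [t [At c1 ->]]]].
  have -> : z0 = \sum_i c i *: z0 by rewrite -scaler_suml c1 scale1r.
  rewrite -sumrB; apply: memv_suml => i _; rewrite -scalerBr memvZ//.
  exact: AW.
move=> Ax Ay; have [z0 Az0] : exists z, A z.
  case: Ax => -[|n] [c [t [At c1 _]]]; last by exists (t ord0).
  by move: c1; rewrite big_ord0 => /eqP; rewrite eq_sym oner_eq0.
have -> : x - y = (x - z0) - (y - z0) by to_coordinates; ring.
by apply: memvB; exact: affW.
Qed.

Lemma direction_eq A W : is_direction A W -> direction A = W.
Proof.
move=> [AW Wmin]; have [AD Dmin] := directionP A.
by apply/eqP; rewrite eqEsubv Dmin// Wmin.
Qed.

Lemma adim_direction A W : is_direction A W -> adim A = \dim W.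
Proof.
move=> [AW Wmin]; rewrite /adim; congr (\dim _); apply: direction_eq.
by split=> [|W' /aff_differences]; [exact/aff_differences|exact: Wmin].
Qed.

Lemma adim_is_direction A : exists2 D, is_direction A D & adim A = \dim D.
Proof.
have [AD Dmin] := directionP A; exists (direction A) => //.
by apply: adim_direction; split.
Qed.

(** Covers the empty set as well, which also has dimension 0. *)
Lemma is_direction_singleton A : (forall x y, A x -> A y -> x = y) ->
  is_direction A 0%VS.
Proof.
move=> A1; split=> [x y Ax Ay|W _]; last exact: sub0v.
by rewrite (A1 x y)// subrr mem0v.
Qed.

Section Cone.
Variable C : set V.
Hypothesis HC : convex_linear_cone C.

Lemma linear_cone0 : C 0.
Proof.
by case: HC => -[x Cx] _ /(_ x 0 Cx (lexx 0)); rewrite scale0r.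
Qed.

Lemma linear_coneZ l v : 0 <= l -> C v -> C (l *: v).
Proof. by case: HC => _ _ CZ l0 Cv; exact: CZ. Qed.

Lemma linear_coneD u v : C u -> C v -> C (u + v).
Proof.
move=> Cu Cv; case: HC => _ cC CZ.
have /(CZ _ 2) : C (2^-1 *: u + 2^-1 *: v).
  have h0 : (0 : R) <= 2^-1 by [].
  have h1 : (2^-1 : R) <= 1 by lra.
  have := cC u v (Itv01 h0 h1); rewrite !inE => /(_ Cu Cv).
  rewrite /conv /= (_ : unstable.onem 2^-1 = 2^-1); first exact.
  by rewrite /unstable.onem; field.
by rewrite scalerDr !scalerA mulfV// !scale1r; apply.
Qed.

(** The differences of elements of [C] form a subspace: a negative scalar exchanges the two
    terms. *)
Lemma cone_span : exists W, [/\ forall x, C x -> x \in W,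
  forall x, aff C x <-> x \in W, is_direction C W &
  forall x, x \in W -> exists u v, [/\ C u, C v & x = u - v]].
Proof.
pose A := [set x | exists u v, [/\ C u, C v & x = u - v]].
have C0 := linear_cone0.
have [W WA] : exists W, forall x, x \in W <-> A x.
  apply: vspace_of_set; first by exists 0, 0; rewrite subr0.
  move=> k _ _ [u [v [Cu Cv ->]]] [u' [v' [Cu' Cv' ->]]].
  have [k0|k0] := leP 0 k.
    exists (k *: u + u'), (k *: v + v'); split.
    - by apply: linear_coneD => //; exact: linear_coneZ.
    - by apply: linear_coneD => //; exact: linear_coneZ.
    - by to_coordinates; ring.
  have Nk0 : 0 <= - k by lra.
  exists ((- k) *: v + u'), ((- k) *: u + v'); split.
  - by apply: linear_coneD => //; exact: linear_coneZ.
  - by apply: linear_coneD => //; exact: linear_coneZ.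
  - by to_coordinates; ring.
have CW x : C x -> x \in W by move=> Cx; apply/WA; exists x, 0; rewrite subr0.
exists W; split=> //.
- move=> x; split=> [[n [c [y [Cy _ ->]]]]|/WA[u [v [Cu Cv ->]]]].
    by apply: memv_suml => i _; rewrite memvZ// CW.
  (* The third point 0, which lies in [C], carries the weight missing from [u - v]. *)
  exists 3%N, (fun i => [:: 1; 1; -1]`_i), (fun i => [:: 0; u; v]`_i).
  split=> [[[|[|[|//]]] ?]//||]; first by rewrite !big_ord_recr big_ord0 /=;
    ring.
  by rewrite !big_ord_recr big_ord0 /= scaler0 !add0r scale1r scaleN1r.
- split=> [x y Cx Cy|W' CW']; first by rewrite memvB ?CW.
  apply/subvP => x /WA[u [v [Cu Cv ->]]].
  by rewrite -[u]subr0 -[v]subr0; apply: memvB; exact: CW'.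
- by move=> x /WA.
Qed.

End Cone.

Lemma aff_reflection A W a : (forall x, aff A x <-> x \in W) -> a \in W ->
  forall x, aff (reflection a A) x <-> x \in W.
Proof.
move=> AW aW x; have reflW y : (a - y \in W) = (y \in W).
  by rewrite rpredBl.
rewrite -reflW -AW; split=> -[n [c [y [Ay c1 xE]]]].
  exists n, c, (fun i => a - y i); split=> // [i|].
    by have [z Az <-] := Ay i; rewrite opprB addrC subrK.
  under eq_bigr do rewrite scalerBr.
  by rewrite sumrB -scaler_suml c1 scale1r xE.
exists n, c, (fun i => a - y i); split=> // [i|]; first by exists (y i).
under eq_bigr do rewrite scalerBr.
by rewrite sumrB -scaler_suml c1 scale1r -xE opprB addrC subrK.
Qed.

End AffineSpan.

(** * The topology of a finite-dimensional space *)

Section Topology.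
Variables (R : realType) (V : vectType R).
Implicit Types (x v a : V) (C K : set V) (W : {vspace V}).

Lemma coordinates_is_linear : linear (@coordinates R V).
Proof. by move=> k u v; apply/rowP => i; rewrite !mxE linearD linearZ. Qed.

Lemma coordinatesD u v : coordinates (u + v) = coordinates u + coordinates v.
Proof. by rewrite -[u]scale1r coordinates_is_linear !scale1r. Qed.

Lemma coordinates0 : @coordinates R V 0 = 0.
Proof. by apply: (addrI (coordinates 0)); rewrite -coordinatesD !addr0. Qed.

Lemma coordinatesZ k v : coordinates (k *: v) = k *: coordinates v.
Proof. by rewrite -[k *: v]addr0 coordinates_is_linear coordinates0 addr0. Qed.

Lemma coordinates_inj : injective (@coordinates R V).
Proof.
by move=> u v /rowP uv; apply: coordf_inj => i; have := uv i; rewrite !mxE.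
Qed.

Definition of_coordinates (r : 'rV[R]_(\dim {:V})) : V :=
  \sum_i r 0 i *: (vbasis {:V})`_i.

Lemma of_coordinatesK : cancel of_coordinates (@coordinates R V).
Proof.
move=> r; apply/rowP => i; rewrite mxE.
by rewrite coord_sum_free ?(basis_free (vbasisP _)).
Qed.

Lemma line_continuous x v : continuous (fun t : R => x + t *: v : fdtop V).
Proof.
apply: continuous_comp_initial => t.
rewrite /continuous_at /comp.
have E s : coordinates (x + s *: v) = coordinates x + s *: coordinates v.
  by rewrite coordinatesD coordinatesZ.
rewrite E; under eq_fun do rewrite E.
by apply: cvgD; [exact: cvg_cst|apply: cvgZr_tmp; exact: cvg_id].
Qed.

Lemma coordinates_continuous : continuous (@coordinates R V : fdtop V -> _).
Proof. exact: initial_continuous. Qed.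

Lemma of_coordinates_continuous : continuous (of_coordinates : _ -> fdtop V).
Proof.
apply: continuous_comp_initial => r; rewrite /continuous_at /comp.
by rewrite of_coordinatesK; under eq_fun do rewrite of_coordinatesK;
  exact: cvg_id.
Qed.

Lemma reflect_continuous a : continuous (fun y : fdtop V => a - y : fdtop V).
Proof.
apply: continuous_comp_initial => y; rewrite /continuous_at /comp.
have E z : coordinates (a - z) = coordinates a - coordinates z.
  by rewrite -scaleN1r coordinatesD coordinatesZ scaleN1r.
rewrite E (funext E).
apply: (@cvg_comp _ _ _ (@coordinates R V) (fun r => coordinates a - r)).
  exact: coordinates_continuous.
by apply: cvgB; [exact: cvg_cst|exact: cvg_id].
Qed.

Lemma functional_continuous (l : V -> R) : scalar l ->
  continuous (l : fdtop V -> R).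
Proof.
move=> ll y.
have [c E] : exists c, forall z, l z = \sum_i coordinates z 0 i * c i.
  exists (fun i : 'I__ => l (vbasis {:V})`_i) => z.
  have [T Tl] := linear_hom (ll : linear (l : V -> R^o)).
  rewrite -Tl [in LHS](coord_vbasis (memvf z)) linear_sum; apply: eq_bigr =>
    i _.
  by rewrite linearZ /= Tl mxE.
rewrite /continuous_at E (funext E).
apply: (@cvg_comp _ _ _ (@coordinates R V)
  (fun r => \sum_i r 0 i * c i)); first exact: coordinates_continuous.
apply: cvg_big => [|i _]; first exact: add_continuous.
by apply: cvgM; [exact: coord_continuous|exact: cvg_cst].
Qed.

Lemma closed_archimedean C u v : closed (C : set (fdtop V)) ->
  (forall e : R, 0 < e -> C (v + e *: u)) -> C v.
Proof.
move=> cC Cv; apply: cC => B vB.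
have /(@line_continuous v u 0)/nbhs_ballP[e /= e0 eB] :
    nbhs (v + 0 *: u : fdtop V) B by rewrite scale0r addr0.
have e2 : 0 < e / 2 by rewrite divr_gt0.
exists (v + (e / 2) *: u); split; first exact: Cv.
by apply: eB; rewrite /ball /= sub0r normrN gtr0_norm// gtr_pMr// invf_lt1//
  ltr1n.
Qed.

Lemma relintP K x : relint K x <->
  aff K x /\ exists2 B, nbhs (x : fdtop V) B & B `&` aff K `<=` K.
Proof.
rewrite /relint /interior /=; case: (nbhs_subspaceP (aff K : set (fdtop V)) x).
  move=> Kx; split=> [H|[_ [B xB BK]]].
    split=> //; exists [set y | aff K y -> K y]; first exact: H.
    by move=> y [H1 H2]; exact: H1.
  by apply: filterS xB => y yB Ky; exact: BK.
by move=> Kx; split=> [H|[]] //; case: Kx; apply: mem_aff; exact: H.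
Qed.

Lemma relint_reflection K W a x : (forall y, aff K y <-> y \in W) -> a \in W ->
  relint (reflection a K) x <-> relint K (a - x).
Proof.
move=> KW aW; rewrite !relintP (aff_reflection KW aW).
rewrite KW rpredBl//.
have reflE y : reflection a K y <-> K (a - y).
  split=> [[z Kz <-]|Ky]; first by rewrite opprB addrC subrK.
  by exists (a - y) => //; rewrite opprB addrC subrK.
have EK z : reflection a K (a - z) -> K z by move=> /reflE;
  rewrite opprB addrC subrK.
split=> -[xW [B xB BK]]; split=> //; exists [set y | B (a - y)].
- by apply: (@reflect_continuous a (a - x)); rewrite opprB addrC subrK.
- by move=> y [/= yB /KW yW]; apply: EK; apply: BK; split=> //;
  apply/(aff_reflection KW aW); rewrite rpredBl.
- exact: (@reflect_continuous a x).
- move=> y [/= yB /(aff_reflection KW aW) yW]; apply/reflE; apply: BK;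
  split=> //.
  by apply/KW; rewrite rpredBl.
Qed.

Lemma relbd_closed K x : closed (K : set (fdtop V)) ->
  relbd K x <-> K x /\ ~ relint K x.
Proof.
move=> cK; rewrite /relbd.
have /closure_id <- : closed (K : set (subspace (aff K : set (fdtop V)))).
  exact: closed_subspaceW.
by [].
Qed.

Lemma relbd_reflection K W a x : closed (K : set (fdtop V)) ->
  (forall y, aff K y <-> y \in W) -> a \in W ->
  relbd (reflection a K) x <-> relbd K (a - x).
Proof.
move=> cK KW aW; rewrite relbd_closed; last first.
  have -> : reflection a K = (fun y => a - y) @^-1` K.
    apply/seteqP; split=> y /=; first by move=> [z Kz <-];
      rewrite opprB addrC subrK.
    by move=> Ky; exists (a - y) => //; rewrite opprB addrC subrK.
  exact: (@closed_comp (fdtop V) (fdtop V) (fun y => a - y) K (fun z _ =>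
    @reflect_continuous a z) cK).
rewrite (relbd_closed _ cK) (relint_reflection _ KW aW).
suff -> : reflection a K x <-> K (a - x) by [].
split=> [[z Kz <-]|Ky]; first by rewrite opprB addrC subrK.
by exists (a - x) => //; rewrite opprB addrC subrK.
Qed.

End Topology.

(** * Algebraic description of the relative interior of a cone *)

Section ConeTopology.
Variables (R : realType) (V : vectType R) (C : set V) (W : {vspace V}).
Hypothesis HC : convex_linear_cone C.
Hypothesis affC : forall x, aff C x <-> x \in W.

Lemma segment_mem x b e s : C x -> 0 < e -> C (x + e *: b) -> 0 <= s <= e ->
  C (x + s *: b).
Proof.
move=> Cx e0 Ce /andP[s0 se].
have -> : x + s *: b = (1 - s / e) *: x + (s / e) *: (x + e *: b).
  by to_coordinates; field; rewrite gt_eqF.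
apply: (linear_coneD HC); apply: (linear_coneZ HC) => //.
  by rewrite subr_ge0 ler_pdivrMr// mul1r.
by rewrite divr_ge0// ltW.
Qed.

Lemma relint_coneP x : relint C x <->
  x \in W /\ forall v, v \in W -> exists2 e, 0 < e & C (x + e *: v).
Proof.
rewrite relintP affC; split=> -[xW H]; split=> //.
  move=> v vW; case: H => B xB BC.
  have /(@line_continuous _ _ x v 0)/nbhs_ballP[e /= e0 eB] :
    nbhs (x + 0 *: v : fdtop V) B by rewrite scale0r addr0.
  exists (e / 2); first by rewrite divr_gt0.
  apply: BC; split; last by apply/affC; rewrite memvD// memvZ.
  apply: eB; rewrite /ball /= sub0r normrN gtr0_norm ?divr_gt0//.
  by rewrite gtr_pMr// invf_lt1// ltr1n.
have Cx : C x by have [e _] := H 0 (mem0v _); rewrite scaler0 addr0.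
pose b j := (vbasis W)`_j; pose n := \dim W.
have /choice[e eP] : forall j : 'I_n, exists e, 0 < e /\
    forall s, `|s| <= e -> C (x + s *: b j).
  move=> j; have bW : b j \in W by apply: vbasis_mem;
    rewrite mem_nth ?size_tuple.
  have [e1 e10 C1] := H _ bW.
  have bNW : - b j \in W by rewrite memvN.
  have [e2 e20] := H _ bNW; rewrite scalerN -scaleNr => C2.
  exists (Num.min e1 e2); split=> [|s]; first by rewrite lt_min e10.
  rewrite le_min => /andP[s1 s2]; have [s0|s0] := leP 0 s.
    by apply: segment_mem C1 _ => //; rewrite s0 -(ger0_norm s0).
  rewrite -[s]opprK scaleNr -scalerN; apply: segment_mem e20 _ _ => //.
    by rewrite scalerN -scaleNr.
  by rewrite -(ltr0_norm s0) s2 normr_ge0.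
(* A point [y] of this set is the average of [x] and the [n] points obtained from [x] by moving
   along one basis vector, [n.+1] times as far as [y] does; hence the division by [n.+1]. *)
exists [set y | forall j : 'I_n, `|coord (vbasis W) j (x - y)| < e j / n.+1%:R].
  have FF : Filter (nbhs (x : fdtop V)) := nbhs_filter _.
  apply: (@filter_forall _ _ (fun (j : 'I_(\dim W)) (y : V) =>
    `|coord (vbasis W) j (x - y)| < e j / n.+1%:R) _ FF) => j.
  have lj : scalar (coord (vbasis W) j) by move=> k u v;
    rewrite linearD linearZ.
  have /cvgr_dist_lt := @functional_continuous _ _ _ lj x.
  move=> /(_ (e j / n.+1%:R)); rewrite divr_gt0 ?(proj1 (eP j)) ?ltr0Sn// =>
    /(_ isT).
  by apply: filterS => y /=; rewrite -linearB.
move=> y [/= yB /affC yW].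
have {}yB (j : 'I_n) : `|n.+1%:R * coord (vbasis W) j (y - x)| <= e j.
  rewrite normrM ger0_norm// mulrC -ler_pdivlMr ?ltr0Sn//.
  by rewrite -[y - x]opprB linearN normrN; exact/ltW/yB.
have -> : y = n.+1%:R^-1 *: (x + \sum_(j < n)
    (x + (n.+1%:R * coord (vbasis W) j (y - x)) *: b j)).
  rewrite big_split /= sumr_const card_ord addrA -mulrS scalerDr scaler_sumr.
  rewrite -(scaler_nat _ x) scalerA mulVf ?pnatr_eq0// scale1r.
  under eq_bigr do rewrite scalerA mulrA mulVf ?pnatr_eq0// mul1r.
  by rewrite -coord_vbasis ?memvB// addrC subrK.
apply: (linear_coneZ HC); first by rewrite invr_ge0.
apply: (linear_coneD HC) => //.
elim/big_ind: _ => [|u v|j _]; [exact: linear_cone0|exact: linear_coneD|].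
by apply: (proj2 (eP j)).
Qed.

End ConeTopology.

(** * Compactness: order intervals are bounded *)

Section BoundedIntervals.
Variables (R : realType) (V : vectType R) (C : set V).
Hypothesis HC : convex_linear_cone C.
Hypothesis closedC : closed (C : set (fdtop V)).
Hypothesis salientC : forall v, C v -> C (- v) -> v = 0.

(** Otherwise suitable vectors [v k], scaled to norm 1, accumulate at a unit vector [p]. As
    [x - v k] and [x + v k] lie in [C], so do [p] and [- p] in the limit, against salience. *)
Lemma interval_coordinates_bounded x : exists K,
  forall v, C (x - v) -> C (x + v) -> `|coordinates v| <= K.
Proof.
apply: contrapT => unbounded.
have /choice[v vP] : forall k : nat, exists v,
    [/\ C (x - v), C (x + v) & k%:R < `|coordinates v|].
  move=> k; apply: contrapT => /forallNP kP; apply: unbounded;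
    exists k%:R => v C1 C2.
  by rewrite leNgt; apply/negP => kv; apply: (kP v).
have Cx : C x.
  have [C1 C2 _] := vP 0%N; have := linear_coneD HC C1 C2.
  have -> : x - v 0%N + (x + v 0%N) = 2 *: x by to_coordinates; ring.
  by move=> /(linear_coneZ HC (l := 2^-1)); rewrite scalerA mulVf// scale1r;
    apply.
pose N k := `|coordinates (v k)|.
have N0 k : 0 < N k by have [_ _] := vP k; apply: le_lt_trans.
pose u k : 'rV[R]_(\dim {:V}) := (N k)^-1 *: coordinates (v k).
have compS : compact [set r : 'rV[R]_(\dim {:V}) | `|r| = 1].
  apply: bounded_closed_compact.
    by exists 1; split=> // M M1 r /= ->; exact: ltW.
  apply: (@closed_comp _ _ (fun r : 'rV[R]_(\dim {:V}) => `|r|) [set 1]) =>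
    [r _|].
    exact: norm_continuous.
  exact: closed_eq.
have uS k : `|u k| = 1.
  by rewrite normrZ gtr0_norm ?invr_gt0// mulVf ?gt_eqF.
have [p [p1 pu]] : [set r | `|r| = 1] `&` cluster (u @ \oo) !=set0.
  apply: (compS (u @ \oo) (fmap_proper_filter u eventually_filter)).
  by exists 0%N => // k _ /=.
have of_coordinatesE (s e : R) r :
    of_coordinates (s *: r + e *: coordinates x) = s *: of_coordinates r + e *:
      x.
  apply: coordinates_inj.
  by rewrite of_coordinatesK coordinatesD !coordinatesZ of_coordinatesK.
(* The margin [e *: x] absorbs [x] divided by [N k] for large [k], so the cluster point lies in the
   closed set [D]; then [e] tends to 0. *)
have Cp (s : R) : `|s| = 1 -> C (s *: of_coordinates p).
  move=> s1; apply: (@closed_archimedean _ _ _ x) => // e e0.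
  rewrite -of_coordinatesE.
  pose D := [set r | C (of_coordinates (s *: r + e *: coordinates x))].
  have cD : closed D.
    pose f r : fdtop V := of_coordinates (s *: r + e *: coordinates x).
    suff cf : continuous f by exact: (@closed_comp _ _ f C (fun r _ =>
      cf r) closedC).
    pose g (r : 'rV[R]_(\dim {:V})) := s *: r + e *: coordinates x.
    have cg : continuous g.
      have cs := @scaler_continuous R 'rV[R]_(\dim {:V}) s.
      by move=> r; exact: (cvgD (cs r) (cvg_cst (e *: coordinates x))).
    move=> r; exact: (@continuous_comp _ _ (fdtop V) g (@of_coordinates R V) r
      (cg r) (@of_coordinates_continuous R V (g r))).
  apply: (cD) => B pB; apply: pu => //; rewrite /D.
  have [k0 k0e] : exists k : nat, e^-1 < k%:R.
    by exists (Num.truncn `|e^-1|).+1; rewrite (le_lt_trans (ler_norm _))//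
      truncnS_gt.
  exists k0 => // k /= k0k; rewrite of_coordinatesE.
  have Ne : (N k)^-1 < e.
    rewrite invf_plt ?posrE//; apply: (lt_trans k0e).
    by have [_ _] := vP k; apply: le_lt_trans; rewrite ler_nat.
  have -> : of_coordinates (u k) = (N k)^-1 *: v k.
    by apply: coordinates_inj; rewrite of_coordinatesK coordinatesZ.
  have -> : s *: ((N k)^-1 *: v k) + e *: x =
      (N k)^-1 *: (x + s *: v k) + (e - (N k)^-1) *: x.
    by to_coordinates; ring.
  apply: (linear_coneD HC); apply: (linear_coneZ HC) => //;
    last by rewrite subr_ge0 ltW.
    by rewrite invr_ge0 ltW.
  have [C1 C2 _] := vP k; have /eqP := s1; rewrite eqr_norml ler01 andbT.
  by move=> /orP[] /eqP ->; rewrite ?scale1r ?scaleN1r.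
have p0 : of_coordinates p = 0.
  apply: salientC; first by rewrite -[X in C X]scale1r; apply: Cp;
    exact: normr1.
  by rewrite -scaleN1r; apply: Cp; rewrite normrN1.
have pE : p = 0 by rewrite -[p](@of_coordinatesK R V) p0 coordinates0.
by move: p1; rewrite /= pE normr0 => /eqP; rewrite eq_sym oner_eq0.
Qed.

Lemma interval_bounded_functional (l : V -> R) x : scalar l -> exists K,
  forall v, C (x - v) -> C (x + v) -> `|l v| <= K.
Proof.
move=> ll; have [T Tl] := linear_hom (ll : linear (l : V -> R^o)).
have [K xK] := interval_coordinates_bounded x.
exists (\sum_(i < \dim {:V}) K * `|l (vbasis {:V})`_i|) => v C1 C2.
rewrite -Tl (coord_vbasis (memvf v)) linear_sum (le_trans (ler_norm_sum _ _
  _))//.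
apply: ler_sum => i _; rewrite linearZ /= Tl normrM ler_wpM2r//.
apply: le_trans (xK v C1 C2); have -> : coord (vbasis {:V}) i v =
  coordinates v 0 i.
  by rewrite mxE.
by rewrite [leRHS]/Num.norm /= mx_normrE; apply/bigmax_geP; right;
  exists (ord0, i).
Qed.

End BoundedIntervals.

(** The coefficient along [a] modulo [D] is unique, hence linear. *)
Lemma scalar_modulo (R : realType) (V : vectType R) (D : {vspace V}) (a : V)
    (m : V -> R) : a \notin D -> (forall v, v - m v *: a \in D) -> scalar m.
Proof.
move=> aD mD k u v; apply/eqP; rewrite -subr_eq0; apply: contraNT aD => d0.
suff : (m (k *: u + v) - (k * m u + m v)) *: a \in D
  by rewrite rpredZeq (negPf d0).
have -> : (m (k *: u + v) - (k * m u + m v)) *: a =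
  k *: (u - m u *: a) + (v - m v *: a) - (k *: u + v - m (k *: u + v) *: a).
  by to_coordinates; ring.
by rewrite memvB// memvD// memvZ.
Qed.

Lemma dim_lker_functional (R : realType) (V : vectType R) (T : 'Hom(V, R^o)) u :
  T u != 0 -> (\dim (lker T)).+1 = \dim {:V}.
Proof.
move=> Tu; rewrite -(limg_ker_dim T fullv) capfv -addn1; congr (_ + _)%N.
apply/eqP; rewrite eqn_leq; apply/andP; split; last first.
  by rewrite (leq_trans (dimvS (subvf _)))// dimvf.
by rewrite lt0n dimv_eq0; apply: contraNneq Tu => T0;
  rewrite -memv0 -T0 memv_img ?memvf.
Qed.

(** * Flat boundary intersections and linearity of the midpoint *)

Section ConeCases.
Variables (R : realType) (V : vectType R) (C : set V) (W : {vspace V}).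
Hypothesis HC : convex_linear_cone C.
Hypothesis closedC : closed (C : set (fdtop V)).
Hypothesis affC : forall x, aff C x <-> x \in W.
Hypothesis dirC : is_direction C W.

Lemma cone_mem_span x : C x -> x \in W.
Proof. by move=> /mem_aff /affC. Qed.

Lemma adim_cone : adim C = \dim W.
Proof. exact: adim_direction. Qed.

(** Take [D] of maximal dimension such that some [e] in [C] can be moved inside [C] in all
    directions of [D]. For [x] in [C], the point [e + x] also allows the direction [x], so [D]
    contains [C]. *)
Lemma relint_nonempty : exists x, relint C x.
Proof.
pose P n := `[< exists e (D : {vspace V}), [/\ C e, \dim D = n &
  forall v, v \in D -> exists2 t, 0 < t & C (e + t *: v)] >].
have exP : exists n, P n.
  exists 0%N; apply/asboolP; exists 0, 0%VS; split; rewrite ?dimv0//.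
    exact: linear_cone0.
  move=> v; rewrite memv0 => /eqP ->; exists 1 => //.
  by rewrite scaler0 addr0; exact: linear_cone0.
have ubP n : P n -> (n <= \dim {:V})%N.
  by move=> /asboolP[e [D [_ <- _]]]; exact/dimvS/subvf.
case: (ex_maxnP exP ubP) => n /asboolP[e [D [Ce dD De]]] maxn.
have WD : (W <= D)%VS.
  suff CD x : C x -> x \in D.
    by apply: (proj2 dirC) => x y Cx Cy; rewrite memvB ?CD.
  move=> Cx.
  have dDx : (\dim (D + <[x]>)%VS <= \dim D)%N.
    rewrite dD; apply: maxn; apply/asboolP; exists (e + x), (D + <[x]>)%VS.
    split=> [||v]; [exact: linear_coneD|by []|].
    move=> /memv_addP[d dD1 [_ /vlineP[k ->] ->]].
    have [t t0 Ct] := De d dD1.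
    (* The second bound keeps [1 + s * k], the coefficient of [x], nonnegative. *)
    exists (Num.min t (`|k| + 1)^-1).
      by rewrite lt_min t0 invr_gt0 ltr_wpDl.
    set s := Num.min _ _.
    have s0 : 0 <= s by rewrite le_min ltW//= invr_ge0 addr_ge0.
    have -> : e + x + s *: (d + k *: x) = (e + s *: d) + (1 + s * k) *: x.
      by to_coordinates; ring.
    apply: (linear_coneD HC).
      by apply: (segment_mem HC Ce t0 Ct); rewrite s0 ge_min lexx.
    apply: (linear_coneZ HC) => //.
    have : s * `|k| <= 1.
      have : s * (`|k| + 1) <= 1.
        by rewrite -ler_pdivlMr ?ltr_wpDl// div1r ge_min lexx orbT.
      by rewrite mulrDr; lra.
    by rewrite -[s in s * `|k|]ger0_norm// -normrM => /ler_normlP[]; lra.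
  have /eqP -> : D == (D + <[x]>)%VS by rewrite eqEdim addvSl.
  by apply: (subvP (addvSr D <[x]>)); exact: memv_line.
exists e; apply/(relint_coneP HC affC); split; first exact: cone_mem_span.
by move=> v vW; exact/De/(subvP WD).
Qed.

Lemma relintZ t x : 0 < t -> relint C x -> relint C (t *: x).
Proof.
move=> t0 /(relint_coneP HC affC)[xW xi]; apply/(relint_coneP HC affC).
split=> [|v vW]; first exact: memvZ.
have [e e0 Ce] := xi v vW; exists (t * e); first exact: mulr_gt0.
by rewrite -scalerA -scalerDr; apply: (linear_coneZ HC) => //; exact: ltW.
Qed.

(* [C] may be a whole line here: since a line meets a transversal hyperplane in
   the origin only, it is pointed. *)
Lemma FBI_adim1 : adim C = 1%N -> FBI C.
Proof.
rewrite /FBI adim_cone => W1 a ai; have /(relint_coneP HC affC)[aW ai'] := ai.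
suff dI : is_direction (relbd C `&` relbd (reflection a C)) 0%VS.
  by rewrite (adim_direction dI) dimv0 W1.
apply: is_direction_singleton => z y [/(relbd_closed _ closedC)[Cz zi]] az _.
move: az => /(relbd_reflection _ closedC affC aW)/(relbd_closed _ closedC)[Caz
  azi].
have zW := cone_mem_span Cz.
(* If [a = 0], an interior origin makes [C] the whole span, which has no relative boundary. *)
have [a0|a0] := eqVneq a 0.
  case: zi; apply/(relint_coneP HC affC); split=> // v vW; exists 1 => //.
  rewrite scale1r; have [e e0] := ai' _ (memvD zW vW).
  rewrite a0 add0r => /(linear_coneZ HC (l := e^-1)).
  by rewrite invr_ge0 scalerA mulVf ?gt_eqF// scale1r; apply; exact: ltW.
have : z \in <[a]>%VS.
  suff /eqP -> : (<[a]> == W)%VS by [].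
  by rewrite eqEdim -memvE aW W1 dim_vline a0.
(* Either [t] or [1 - t] is positive, so [z] or [a - z] is interior: the boundaries do not meet. *)
move=> /vlineP[t zE]; have [t0|t0] := ltP 0 t.
  by case: zi; rewrite zE; exact: relintZ.
case: azi; have -> : a - z = (1 - t) *: a by rewrite zE; to_coordinates; ring.
by apply: relintZ => //; lra.
Qed.

Lemma ellipsoid_origin : ellipsoid ([set 0] : set V).
Proof.
pose b (x y : R^o) : R := x * y.
have [d dE] : exists d : {dot R^o for idfun}, forall u v, d u v = b u v.
  apply: dot_of_form => [u k v w|u v|u u0]; rewrite /b.
  - by rewrite mulrDr; congr (_ + _); rewrite /GRing.scale /=; ring.
  - exact: mulrC.
  - by rewrite -expr2 exprn_even_gt0.
exists R^o, d, (0 : 'Hom(R^o, V)), 0; apply/seteqP; split=> y /=.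
  move=> ->; exists 0; last by rewrite lfunE addr0.
  by rewrite /unit_ball /= dE /b mulr0 sqrtr0.
by move=> [x _ <-]; rewrite lfunE addr0.
Qed.

Lemma ellipsoidal_adim1 : pointed C -> adim C = 1%N -> ellipsoidal_cone C.
Proof.
move=> [H [Hh HC0]] C1; exists [set 0]; split; last exact: ellipsoid_origin.
split; last by exists H; rewrite setIC HC0.
rewrite C1 (@adim_direction _ _ _ 0%VS) ?dimv0//.
by apply: is_direction_singleton => x y -> ->.
Qed.

(** A nonzero [v] with [v] and [- v] in [C] is transversal to the hyperplane. Multiples of [v] then
    move any element of [C] into the hyperplane without leaving [C], hence to 0, so [C] lies on a
    line. *)
Lemma pointed_salient : pointed C -> (1 < adim C)%N ->
  forall v, C v -> C (- v) -> v = 0.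
Proof.
move=> [H [[p [K [dK HE]]] HC0]]; rewrite adim_cone => C2 v Cv CNv.
have HK x : H x <-> x \in K.
  have [+ _] : (H `&` C) 0 by rewrite HC0.
  rewrite HE /= sub0r memvN => pK; split=> [|xK]; last exact: memvB.
  by move=> xpK; rewrite -[x](subrK p) memvD.
have C0 x : C x -> x \in K -> x = 0.
  by move=> Cx /HK Hx; have : (H `&` C) x by []; rewrite HC0.
apply/eqP; apply: contraTT C2 => v0; rewrite -leqNgt.
have vK : v \notin K by apply: contra v0 => vK; rewrite (C0 v).
have Kv : (K + <[v]>)%VS = fullv.
  apply/eqP; rewrite eqEdim subvf/= -dK ltnNge; apply: contra vK => le.
  have /eqP -> : K == (K + <[v]>)%VS by rewrite eqEdim addvSl.
  by apply: (subvP (addvSr K <[v]>)); exact: memv_line.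
suff /dimvS : (W <= <[v]>)%VS by move=> /leq_trans; apply; rewrite dim_vline v0.
apply: (proj2 dirC) => x y Cx Cy; suff Cv' z : C z -> z \in <[v]>%VS
  by rewrite memvB ?Cv'.
move=> Cz; have : z \in (K + <[v]>)%VS by rewrite Kv memvf.
move=> /memv_addP[k kK [_ /vlineP[t ->] zE]].
have kE : k = z - t *: v by rewrite zE addrK.
suff k0 : k = 0 by rewrite zE k0 add0r memvZ// memv_line.
apply: C0 kK; rewrite kE; apply: (linear_coneD HC) => //.
have [t0|t0] := leP 0 t; first by rewrite -scalerN; exact: (linear_coneZ HC).
by rewrite -scaleNr; apply: (linear_coneZ HC) => //; lra.
Qed.

End ConeCases.

(** * The cone inside its span, where it has interior points *)

Section SolidCone.
Variables (R : realType) (V : vectType R) (C : set V) (W : {vspace V}).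
Hypothesis HC : convex_linear_cone C.
Hypothesis closedC : closed (C : set (fdtop V)).
Hypothesis affC : forall x, aff C x <-> x \in W.
Hypothesis dirC : is_direction C W.
Hypothesis salientC : forall v, C v -> C (- v) -> v = 0.
Hypothesis dimW : (0 < \dim W)%N.

Local Notation U := (subvs_of W).

Definition span_cone : set U := [set u | C (vsval u)].

Lemma span_cone_salient : salient_cone span_cone.
Proof.
split=> [u v|l v|v|u v H|].
- exact: (linear_coneD HC).
- exact: (linear_coneZ HC).
- by move=> Cv CNv; apply: val_inj; exact: salientC.
- by apply: (closed_archimedean (u := vsval u) closedC) => e /H.
- exists (vsproj W (vpick W)); apply: contraTneq dimW => /(congr1 vsval).
  rewrite vsprojK ?memv_pick// linear0 => /eqP; rewrite vpick0 => /eqP ->.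
  by rewrite dimv0.
Qed.

Lemma relint_aint u : relint C (vsval u) <-> aint span_cone u.
Proof.
rewrite (relint_coneP HC affC); split=> [[_ ui] v|ui];
  first exact: ui (subvsP v).
split=> [|v vW]; first exact: subvsP.
by have [e e0 Ce] := ui (vsproj W v); exists e; rewrite // -[v](vsprojK vW).
Qed.

Lemma span_cone_interval_bounded x i : exists K,
  forall v, span_cone (x - v) -> span_cone (x + v) -> `|coordf i v| <= K.
Proof.
have [|K xK] := interval_bounded_functional HC closedC salientC
  (l := fun v => coordf i (vsproj W v)) (vsval x).
  by move=> k u v; rewrite linearD linearZ coordfD coordfZ.
by exists K => v C1 C2; rewrite -[v]vsvalK; exact: xK.
Qed.

Lemma span_cone_mem x : C x -> exists2 u, x = vsval u & span_cone u.
Proof.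
move=> Cx; have xW := cone_mem_span affC Cx.
by exists (vsproj W x); rewrite /span_cone /= vsprojK.
Qed.

Lemma boundary_meet u z : (relbd C `&` relbd (reflection (vsval u) C)) z <->
  exists2 y, z = vsval y & abd_meet span_cone u y.
Proof.
split=> [[/(relbd_closed _ closedC)[Cz zi]]|[y -> [[y1 y2] [y3 y4]]]].
  move=> /(relbd_reflection _ closedC affC (subvsP u))/(relbd_closed _
    closedC)[Cuz uzi].
  have [y zE Cy] := span_cone_mem Cz; rewrite zE in zi Cuz uzi.
  by exists y => //; split; split => //; rewrite -relint_aint.
split; first by apply/(relbd_closed _ closedC); split=> //; rewrite relint_aint.
apply/(relbd_reflection _ closedC affC (subvsP u))/(relbd_closed _ closedC).
by split=> //; rewrite -linearB relint_aint.
Qed.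

Lemma dim_span : \dim {:U} = \dim W.
Proof. by rewrite dimvf. Qed.

Lemma dim_span_img (K : {vspace U}) : \dim (linfun (@vsval _ _ W) @: K)%VS =
  \dim K.
Proof.
apply: limg_dim_eq; apply/eqP; rewrite -subv0; apply/subvP => x.
rewrite memv_cap memv_ker lfunE memv0 => /andP[_ /eqP x0].
by apply/eqP/val_inj; rewrite /= x0.
Qed.

Local Notation mid := (mid span_cone).
Local Notation aint := (aint span_cone).

Lemma mid_functional u : aint u -> scalar (mid u) ->
  exists2 T : 'Hom(U, R^o), T =1 mid u &
    (\dim (linfun (@vsval _ _ W) @: lker T)%VS).+1 = \dim W.
Proof.
move=> ui lu; have [T TE] := linear_hom (lu : linear (mid u : U -> R^o)).
exists T => //; rewrite dim_span_img (@dim_lker_functional _ _ T u) ?dim_span//.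
by rewrite TE (mid_self span_cone_salient)// oner_eq0.
Qed.

(** By [mid_residual], the direction [D] of the boundary intersection contains every residual
    [v - mid u v *: u]. If [D] has codimension 1, it misses [u], and [mid u] is the coefficient
    along [u] modulo [D]. Conversely, if [mid u] is linear, [D] is its kernel. *)
Lemma FBI_mid : FBI C <-> forall u, aint u -> scalar (mid u).
Proof.
have SC := span_cone_salient.
split=> [fbi u ui|ml a].
  have /fbi := proj2 (relint_aint u) ui; rewrite (adim_cone dirC).
  have [D [DI _] ->] := adim_is_direction (relbd C `&` relbd (reflection (vsval
    u) C)).
  move=> dimD.
  have residD v : vsval v - mid u v *: vsval u \in D.
    have -> : vsval v - mid u v *: vsval u = vsval (v - mid u v *: u).
      by rewrite linearB linearZ.
    have [vE|vN] := eqVneq v (gauge span_cone u v *: u).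
      by rewrite (mid_multiple SC ui vE) {1}vE subrr linear0 mem0v.
    have [z [k [zJ ->]]] := mid_residual SC ui vN.
    rewrite linearZ memvZ// linearB; apply: DI; apply/boundary_meet.
      by exists z.
    by exists (u - z) => //; exact: abd_meet_sym.
  have uD : vsval u \notin D.
    apply/negP => uD; suff /dimvS : (W <= D)%VS by rewrite -dimD ltnn.
    apply/subvP => w wW; rewrite -[w](vsprojK wW).
    by rewrite -[vsval _](subrK (mid u (vsproj W w) *: vsval u)) memvD// memvZ.
  move=> k v w.
  have := scalar_modulo (V := U) (D := (linfun (@vsval _ _ W) @^-1: D)%VS) (a
    := u)
    (m := mid u).
  rewrite -!memv_preim lfunE; apply=> // v'.
  by rewrite -memv_preim lfunE; exact: residD.
move=> ai; have /(relint_coneP HC affC)[aW _] := ai.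
rewrite -[a](vsprojK aW) in ai *; set u := vsproj W a in ai *.
have {}ai := proj1 (relint_aint u) ai.
have [T TE dT] := mid_functional ai (ml u ai).
rewrite (adim_cone dirC) -dT; congr _.+1; apply: adim_direction;
  split=> [x y|D' D'I].
  move=> /boundary_meet[x' -> xJ] /boundary_meet[y' -> yJ].
  have -> : vsval x' - vsval y' = linfun (@vsval _ _ W) (x' - y')
    by rewrite lfunE.
  rewrite memv_img// memv_ker linearB /= !TE.
  by rewrite !(mid_abd_meet SC)// subrr.
apply/subvP => _ /memv_imgP[v + ->]; rewrite memv_ker TE lfunE /= => /eqP mv.
have [vE|vN] := eqVneq v (gauge span_cone u v *: u).
  by rewrite vE -(mid_multiple SC ai vE) mv scale0r linear0 mem0v.
have [z [k [zJ]]] := mid_residual SC ai vN; rewrite mv scale0r subr0 => ->.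
rewrite linearZ memvZ// linearB; apply: D'I; apply/boundary_meet.
  by exists z.
by exists (u - z) => //; exact: abd_meet_sym.
Qed.

Lemma mid_ellipsoidal : (forall u, aint u -> scalar (mid u)) ->
  ellipsoidal_cone C.
Proof.
move=> ml; have SC := span_cone_salient.
have [e ei] : exists e, aint e.
  have [x xi] := relint_nonempty HC affC dirC.
  have /(relint_coneP HC affC)[xW _] := xi.
  by exists (vsproj W x); apply/relint_aint; rewrite vsprojK.
have IB := span_cone_interval_bounded.
have [T TE dT] := mid_functional ei (ml e ei).
pose K := lker T; pose E := subvs_of K.
pose g (x : E) := gauge span_cone e (vsval x).
have KE (v : U) : (v \in K) = (mid e v == 0) by rewrite memv_ker TE.
have gN x : gauge span_cone e (- vsval x) = g x.
  have := subvsP x; rewrite KE midE -/(g x) => /eqP; lra.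
have g0 x : 0 <= g x by have := gauge_width_ge0 SC (vsval x) ei;
  rewrite gN -/(g x); lra.
(* On the kernel of [mid e] the gauge is even, so [bil_diag] makes this form the square of the
   gauge. *)
pose b (x y : E) := - bil span_cone e (vsval x) (vsval y).
have bE x : b x x = g x ^+ 2 by rewrite /b (bil_diag SC ml IB ei) gN opprK -/(g
  x) expr2.
have [dot dotE] : exists d : {dot E for idfun}, forall x y, d x y = b x y.
  apply: dot_of_form => [u k v w|u v|u u0].
  - rewrite /b; have := bil_scalar SC ml ei (vsval u) k (vsval v) (vsval w).
    by move=> /= ->; ring.
  - by rewrite /b (bil_sym SC ml IB ei).
  - rewrite bE exprn_gt0// lt_neqAle g0 andbT eq_sym;
    apply: contra_neq u0 => gu0.
    apply: val_inj; rewrite /= (gauge_width_eq0 SC ei (v := vsval u)) ?gN -/(g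
      u) gu0 ?addr0//.
    by rewrite scale0r.
pose L : {linear E -> V} := linfun (@vsval _ _ W) \o linfun (@vsval _ _ K).
have LE x : L x = vsval (vsval x) by rewrite /L /= !lfunE.
have ballE x : unit_ball dot x <-> span_cone (e + vsval x).
  rewrite /unit_ball /= dotE bE sqrtr_sqr ger0_norm// (mem_gauge SC _ ei).
  have -> : - (e + vsval x) = - vsval x + (-1) *: e by to_coordinates; ring.
  by rewrite (gauge_shift SC)// gN; split=> ?; lra.
(* A section is cut by a hyperplane of [V], so [mid e] is extended from the span by a projection. *)
pose TV : 'Hom(V, R^o) := (T \o linfun (vsproj W))%VF.
have TVE v : TV v = mid e (vsproj W v) by rewrite comp_lfunE lfunE TE.
pose H := [set x : V | x - vsval e \in lker TV].
have HH : affine_hyperplane H.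
  exists (vsval e), (lker TV); split=> //;
    apply: (@dim_lker_functional _ _ TV (vsval e)).
  by rewrite TVE vsvalK (mid_self SC)// oner_eq0.
have CHE v : (C `&` H) v <->
    exists2 x, unit_ball dot x & v = vsval (e + vsval x).
  have HE u : H (vsval u) = (u - e \in K).
    by rewrite KE /H /= memv_ker TVE -[in RHS](vsvalK (u - e)).
  split=> [[/span_cone_mem[u -> Cu]]|[x /ballE Cx ->]].
    rewrite HE => uK; exists (vsproj K (u - e));
      last by rewrite vsprojK// addrC subrK.
    by apply/ballE; rewrite vsprojK// addrC subrK.
  by split=> //; rewrite HE addrC addKr subvsP.
exists (C `&` H); split; last first.
  exists E, dot, L, (vsval e); apply/seteqP; split=> v.
    by move=> /CHE[x xB ->]; exists x => //; rewrite LE addrC linearD.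
  by move=> [x xB <-]; apply/CHE; exists x; rewrite // LE addrC linearD.
split; last by exists H.
rewrite (adim_cone dirC) -dT; congr _.+1; apply: adim_direction; split.
  move=> x y /CHE[x' _ ->] /CHE[y' _ ->].
  have -> : vsval (e + vsval x') - vsval (e + vsval y') = linfun (@vsval _ _ W)
    (vsval (x' - y')).
    by rewrite lfunE !linearB !linearD /=; to_coordinates; ring.
  by apply: memv_img; exact: subvsP.
move=> W' W'd; apply/subvP => _ /memv_imgP[v vK ->]; rewrite lfunE /=.
(* Since [e] is interior, the section contains a short segment from [e] in each direction of the
   kernel. *)
have [t t0 Ct] := ei v.
have /CHE Se : exists2 x, unit_ball dot x & vsval e = vsval (e + vsval x).
  exists 0; last by rewrite linear0 addr0.
  by apply/ballE; rewrite linear0 addr0; exact: aint_mem.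
have /CHE St : exists2 x, unit_ball dot x & vsval (e + t *: v) =
  vsval (e + vsval x).
  exists (vsproj K (t *: v)); last by rewrite vsprojK// memvZ.
  by apply/ballE; rewrite vsprojK// memvZ.
have := W'd _ _ St Se; rewrite -linearB addrC addKr linearZ rpredZeq gt_eqF//.
Qed.

End SolidCone.

(** * Cones over ellipsoids *)

Lemma hyperplane_functional (R : realType) (V : vectType R) (K : {vspace V}) :
  (\dim K).+1 = \dim {:V} -> exists T : 'Hom(V, R^o), forall x, (T x == 0) =
    (x \in K).
Proof.
move=> dK; have [v vK] : exists v, v \notin K.
  apply: contrapT => /forallNP vK; have : (fullv <= K)%VS.
    by apply/subvP => v _; apply/negPn/negP; exact: vK.
  by move=> /dimvS; rewrite -dK ltnn.
have Kv : (K + <[v]>)%VS = fullv.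
  apply/eqP; rewrite eqEdim subvf/= -dK ltnNge; apply: contra vK => le.
  have /eqP -> : K == (K + <[v]>)%VS by rewrite eqEdim addvSl.
  by apply: (subvP (addvSr K <[v]>)); exact: memv_line.
have /choice[m mK] : forall x, exists k : R, x - k *: v \in K.
  move=> x; have : x \in (K + <[v]>)%VS by rewrite Kv memvf.
  by move=> /memv_addP[k kK [_ /vlineP[t ->] ->]]; exists t; rewrite addrK.
have [T TE] := linear_hom (scalar_modulo vK mK : linear (m : V -> R^o)).
exists T => x; rewrite TE; apply/eqP/idP => [m0|xK].
  by have := mK x; rewrite m0 scale0r subr0.
apply/eqP; apply: contraNT vK => m0.
have : m x *: v \in K by rewrite -[_ *: v](subKr x) memvB.
by rewrite rpredZeq (negPf m0).
Qed.

Lemma quadratic_step (R : realType) (A B D : R) : 0 < A ->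
  exists2 d, 0 < d & forall t, 0 <= t <= d -> 0 <= A + 2 * t * B + t ^+ 2 * D.
Proof.
move=> A0; have N0 : 0 < 2 * `|B| + `|D| + 1.
  by have := normr_ge0 B; have := normr_ge0 D; lra.
(* For [t <= 1] the last two terms are at most [t * (2 * |B| + |D|)] in absolute value; the summand
   1 keeps the denominator positive. *)
exists (Num.min 1 (A / (2 * `|B| + `|D| + 1))).
  by rewrite lt_min ltr01 divr_gt0.
move=> t /andP[t0]; rewrite le_min ler_pdivlMr// => /andP[t1 tA].
have /ler_normlP[B1 B2] := lexx `|B|; have /ler_normlP[D1 D2] := lexx `|D|.
have : t * - `|B| <= t * B by rewrite ler_wpM2l//; lra.
have : t ^+ 2 * - `|D| <= t ^+ 2 * D by rewrite ler_wpM2l ?sqr_ge0//; lra.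
have : t ^+ 2 * `|D| <= t * `|D| by rewrite ler_wpM2r// expr2 ler_piMl.
lra.
Qed.

Section Ellipsoidal.
Variables (R : realType) (V : vectType R) (C : set V) (W : {vspace V}).
Hypothesis HC : convex_linear_cone C.
Hypothesis closedC : closed (C : set (fdtop V)).
Hypothesis affC : forall x, aff C x <-> x \in W.
Hypothesis dirC : is_direction C W.
Hypothesis salientC : forall v, C v -> C (- v) -> v = 0.
Hypothesis dimW : (1 < \dim W)%N.

Lemma recession v c : (forall k, 0 <= k -> C (c - k *: v)) -> C (- v).
Proof.
move=> Cv; apply: (closed_archimedean (u := c) closedC) => e e0.
have -> : - v + e *: c = e *: (c - e^-1 *: v).
  by to_coordinates; field; rewrite gt_eqF.
by apply: (linear_coneZ HC (ltW e0)); apply: Cv; rewrite invr_ge0 ltW.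
Qed.

Lemma ellipsoidal_height : ellipsoidal_cone C ->
  exists (E : vectType R) (dot : {dot E for idfun}) (L : 'Hom(E, V)) (c : V)
    (h : 'Hom(V, R^o)),
    [/\ h c = 1, forall x, h (L x) = 0 &
    forall y, C y <-> 0 <= h y /\
      exists2 x, y - h y *: c = L x & dot x x <= h y ^+ 2].
Proof.
move=> [S [[dimS [_ [[p [K [dK ->]]] SE]]] [E [dot [L [c SL]]]]]].
have [h0 h0K] := hyperplane_functional dK.
have h0B y z : h0 (y - z) = h0 y - h0 z by rewrite linearB.
have memS y : S y <-> C y /\ h0 y = h0 p.
  rewrite SE; split=> -[Cy]; first by rewrite /= -h0K h0B subr_eq0 => /eqP.
  by move=> hy; split=> //=; rewrite -h0K h0B hy subrr.
have ballN x : unit_ball dot x -> unit_ball dot (- x).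
  by rewrite /unit_ball /= hnormN.
have Sc : S c.
  rewrite SL; exists 0; last by rewrite linear0 add0r.
  by rewrite /unit_ball /= linear0 sqrtr0.
have Ssym y : S y -> S (2 *: c - y).
  rewrite SL => -[x xB <-]; exists (- x); first exact: ballN.
  by rewrite linearN; to_coordinates; ring.
have [Cc hc] := (memS c).1 Sc.
(* A ray in [S] is mirrored in the centre [c], so [- y] is a recession direction of [C] too, against
   salience. *)
have rec0 y : (forall k, 0 <= k -> S (c + k *: y)) -> C y -> y = 0.
  move=> Sy Cy; apply: salientC => //; apply: (recession (c := c)) => k k0.
  have -> : c - k *: y = 2 *: c - (c + k *: y) by to_coordinates; ring.
  by have /memS[] := Ssym _ (Sy k k0).
have h0D y z k : h0 (y + k *: z) = h0 y + k * h0 z by rewrite linearD linearZ.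
(* If the hyperplane contained 0, every [y] in [S] would span a ray from [c] in [S]. So [S] would be
   at most the origin and [C] one-dimensional. *)
have eta0 : h0 p != 0.
  apply: contraTneq dimW => p0; rewrite -(adim_cone dirC) -dimS -leqNgt ltnS
    leqn0.
  rewrite (@adim_direction _ _ _ 0%VS) ?dimv0//.
  suff S0 y : S y -> y = 0.
    by apply: is_direction_singleton => x y /S0 -> /S0 ->.
  move=> /memS[Cy hy]; apply: rec0 => // k k0; apply/memS; split.
    by apply: (linear_coneD HC) => //; exact: (linear_coneZ HC).
  by rewrite h0D hy hc p0 mulr0 addr0.
pose h := (h0 p)^-1 *: h0.
have hE y : h y = (h0 p)^-1 * h0 y by rewrite scale_lfunE.
have hc1 : h c = 1 by rewrite hE hc mulVf.
have memS' y : S y <-> C y /\ h y = 1.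
  rewrite memS hE; split=> -[Cy hy]; split=> //; first by rewrite hy mulVf.
  by apply: (mulfI (invr_neq0 eta0)); rewrite hy mulVf.
have LZ k x : L (k *: x) = k *: L x by rewrite linearZ.
have hA y z : h (y + z) = h y + h z by rewrite linearD.
have hZ k y : h (k *: y) = k * h y by rewrite linearZ.
have hD y z k : h (y + k *: z) = h y + k * h z by rewrite hA hZ.
have h00 y : C y -> h y = 0 -> y = 0.
  move=> Cy hy; apply: rec0 => // k k0; apply/memS'; split.
    by apply: (linear_coneD HC) => //; exact: (linear_coneZ HC).
  by rewrite hD hc1 hy mulr0 addr0.
(* If [h y < 0], the combination of [y] and [c] of height 0 vanishes, so [- c] is a positive
   multiple of [y]. *)
have h_ge0 y : C y -> 0 <= h y.
  move=> Cy; rewrite leNgt; apply/negP => hy.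
  have Nhy : 0 < - h y by lra.
  have : y + (- h y) *: c = 0.
    apply: h00; last by rewrite hD hc1 mulr1 subrr.
    by apply: (linear_coneD HC) => //; apply: (linear_coneZ HC) => //;
      exact: ltW.
  move=> /eqP; rewrite addr_eq0 => /eqP yE.
  have : c = 0.
    apply: salientC => //; apply: (@closed_archimedean _ _ _ c) => // e e0.
    have -> : - c = (- h y)^-1 *: y.
      apply: (scalerI (lt0r_neq0 Nhy)).
      by rewrite scalerA mulfV ?gt_eqF// scale1r scalerN [RHS]yE.
    by apply: (linear_coneD HC); apply: (linear_coneZ HC) => //;
      rewrite ?invr_ge0 ltW.
  by move=> c0; move: hc1; rewrite c0 linear0 => /eqP; rewrite eq_sym oner_eq0.
have ballE x : unit_ball dot x <-> dot x x <= 1.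
  rewrite /unit_ball /=; suff -> : (Num.sqrt (dot x x) <= 1) =
    (dot x x <= 1) by [].
  by rewrite -[X in (_ <= X) = _]sqrtr1 ler_sqrt.
have hL x : h (L x) = 0.
  pose d := 1 + dot x x; have d1 : 1 <= d by rewrite lerDl dot_ge0.
  have d0 : 0 < d by lra.
  have : S (L (d^-1 *: x) + c).
    rewrite SL; exists (d^-1 *: x) => //; apply/ballE.
    rewrite dotZZ exprVn mulrC ler_pdivrMr ?exprn_gt0// mul1r.
    by rewrite /d; have := dot_ge0 dot x; nra.
  move=> /memS'[_]; rewrite hA hc1 LZ hZ => hx.
  by apply: (mulfI (invr_neq0 (lt0r_neq0 d0))); rewrite mulr0; lra.
exists E, dot, (linfun L), c, h.
have linL x : linfun L x = L x by rewrite lfunE.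
split=> // [x|y]; first by rewrite linL.
split=> [Cy|[hy [x yx xh]]].
  have hy := h_ge0 y Cy; split=> //.
  have [hy0|hy0] := eqVneq (h y) 0.
    by exists 0; rewrite ?linear0 ?sqr_ge0// (h00 y)// linear0 scale0r subr0.
  have hyp : 0 < h y by rewrite lt_neqAle eq_sym hy0.
  have : S ((h y)^-1 *: y).
    apply/memS'; split; first by apply: (linear_coneZ HC) => //;
      rewrite invr_ge0.
    by rewrite hZ mulVf.
  rewrite SL => -[x /ballE xB xE]; exists (h y *: x).
    rewrite linL LZ; have -> : L x = (h y)^-1 *: y - c by rewrite -xE addrK.
    by to_coordinates; field.
  by rewrite dotZZ ler_piMr ?sqr_ge0.
have [hy0|hy0] := eqVneq (h y) 0.
  have x0 : x = 0.
    apply: contraTeq xh => /(neq0_dnorm_gt0 (s := dot)); rewrite hy0 expr0n /=.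
    by rewrite ltNge.
  move: yx; rewrite hy0 scale0r subr0 x0 linear0 => ->; exact: linear_cone0.
have : S (L ((h y)^-1 *: x) + c).
  rewrite SL; exists ((h y)^-1 *: x) => //; apply/ballE.
  by rewrite dotZZ exprVn mulrC ler_pdivrMr ?exprn_even_gt0// mul1r.
move=> /memS'[+ _]; rewrite LZ -linL -yx => /(linear_coneZ HC hy).
suff -> : h y *: ((h y)^-1 *: (y - h y *: c) + c) = y by [].
by to_coordinates; field.
Qed.

(** The cone is given by [h >= 0] and [b >= 0] for a quadratic form [b] to which
    [mid_linear_of_form] applies. *)
Lemma ellipsoidal_mid : ellipsoidal_cone C ->
  forall u, aint (span_cone C (W := W)) u -> scalar (mid (span_cone C (W := W))
    u).
Proof.
move=> /ellipsoidal_height[E [dot [L [c [h [hc hL CE]]]]]].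
have dimW0 : (0 < \dim W)%N by exact: ltnW.
have SC := span_cone_salient HC closedC salientC dimW0.
(* [L] may have a kernel; projecting orthogonally to it selects the shortest preimage, linearly. *)
have [P [Pker Port]] := orthogonal_projection dot (lker L).
have [F FE] : exists F : 'End(V), forall y, F y = y - h y *: c.
  apply: linear_hom => k u v.
  have -> : h (k *: u + v) = k * h u + h v by rewrite linearD linearZ.
  by to_coordinates; ring.
pose psi := (P \o (L^-1 \o F))%VF.
have psiE y : y \in W -> L (psi y) = y - h y *: c.
  move=> yW; rewrite /psi !comp_lfunE FE.
  have [x ->] : exists x, y - h y *: c = L x.
    have [W' [_ affC' _ WD]] := cone_span HC.
    have /WD[u [v [Cu Cv ->]]] : y \in W' by apply/affC'/affC.
    have [_ [xu xuE _]] := (CE u).1 Cu; have [_ [xv xvE _]] := (CE v).1 Cv.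
    exists (xu - xv); have -> : L (xu - xv) = L xu - L xv by rewrite linearB.
    have -> : h (u - v) = h u - h v by rewrite linearB.
    by rewrite -xuE -xvE; to_coordinates; ring.
  have := Pker (L^-1 (L x))%VF; rewrite memv_ker linearB subr_eq0 => /eqP <-.
  by apply: limg_lfunVK; rewrite memv_img ?memvf.
have psi_min y x : y \in W -> y - h y *: c = L x -> dot (psi y) (psi y) <= dot
  x x.
  move=> yW yx; pose k := x - psi y.
  have kK : k \in lker L by rewrite memv_ker linearB /= psiE// -yx subrr.
  have -> : x = psi y + k by rewrite /k addrC subrK.
  have -> := dotDD dot (psi y) k.
  have -> : dot (psi y) k = 0 by rewrite /psi comp_lfunE; exact: Port.
  by rewrite mulr0 addr0 lerDl dot_ge0.
have memC y : y \in W -> C y <-> 0 <= h y /\ dot (psi y) (psi y) <= h y ^+ 2.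
  move=> yW; split=> [/CE[hy [x xE xh]]|[hy yh]].
    by split=> //; apply: le_trans xh; exact: psi_min.
  by apply/CE; split=> //; exists (psi y); rewrite ?psiE.
have hD y z t : h (y + t *: z) = h y + t * h z by rewrite linearD linearZ.
have psiD y z t : psi (y + t *: z) = psi y + t *: psi z
  by rewrite linearD linearZ.
have dotDr x y z t : dot x (y + t *: z) = dot x y + t * dot x z.
  by rewrite linearD linearZ.
pose b (u v : subvs_of W) :=
  h (vsval u) * h (vsval v) - dot (psi (vsval u)) (psi (vsval v)).
have bD (u v : subvs_of W) t :
    b (u + t *: v) (u + t *: v) = b u u + 2 * t * b u v + t ^+ 2 * b v v.
  rewrite /b.
  have -> : vsval (u + t *: v) = vsval u + t *: vsval v by [].
  rewrite hD psiD (dotDD dot) (dotZZ dot) -[_ *: psi _]add0r dotDr linear0.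
  by ring.
have memb u : span_cone C u <-> 0 <= h (vsval u) /\ 0 <= b u u.
  by rewrite /span_cone /= (memC _ (subvsP u)) /b -expr2 subr_ge0.
apply: (mid_linear_of_form SC (b := b)) => [u k v w|u v|z [Cz zi]|a ai].
- rewrite /b.
  have -> : vsval (k *: v + w) = vsval w + k *: vsval v by rewrite addrC.
  by rewrite hD psiD dotDr; ring.
- by rewrite /b mulrC dotC.
(* If [b z z > 0], then [h z > 0] as well, and both inequalities survive a small step in any
   direction. *)
- have [hz bz] := (memb z).1 Cz.
  apply/eqP; rewrite eq_le bz andbT leNgt; apply/negP => bz0; apply: zi => v.
  have hz0 : 0 < h (vsval z).
    rewrite lt_neqAle hz andbT eq_sym; apply/eqP => hz0.
    by move: bz0; rewrite /b hz0 mulr0 sub0r oppr_gt0 ltNge dot_ge0.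
  have [d d0 dP] := quadratic_step (b z v) (b v v) bz0.
  (* The linear case; halving [h v] compensates the factor 2 of the middle term. *)
  have [d' d'0 d'P] := quadratic_step (h (vsval v) / 2) 0 hz0.
  exists (Num.min d d'); first by rewrite lt_min d0.
  set t := Num.min d d'.
  have t0 : 0 <= t by rewrite le_min !ltW.
  apply/memb; split.
    have := d'P t; rewrite t0 ge_min lexx orbT => /(_ isT).
    by have -> : vsval (z + t *: v) = vsval z + t *: vsval v by [];
      rewrite hD; lra.
  by rewrite bD; apply: dP; rewrite t0 ge_min lexx.
(* Moving from [a] along [- c] lowers [h] but leaves [psi] unchanged, so [b a a] exceeds a
   nonnegative value. *)
- have cC : C c by apply/CE; rewrite hc scale1r subrr; split=> //; exists 0;
  rewrite ?linear0 ?expr1n.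
  have cW := cone_mem_span affC cC.
  have [t t0 /memb] := ai (- vsproj W c).
  have -> : vsval (a + t *: - vsproj W c) = vsval a + (- t) *: c.
    by rewrite scalerN -scaleNr -[in RHS](vsprojK cW).
  move=> [ha].
  have psic : psi c = 0 by rewrite /psi !comp_lfunE FE hc scale1r subrr
    !linear0.
  rewrite /b.
  have -> : vsval (a + t *: - vsproj W c) = vsval a + (- t) *: c.
    by rewrite scalerN -scaleNr -[in RHS](vsprojK cW).
  rewrite hD psiD psic scaler0 addr0 hc in ha *.
  by move=> ba; rewrite gt_eqF//; nra.
Qed.

End Ellipsoidal.

Theorem theorem1p2 (R : realType) (V : vectType R) (C : set V) :
  cone C -> (FBI C <-> ellipsoidal_cone C).
Proof.
move=> [HC ptC clC].
have [W [CW affC dirC _]] := cone_span HC.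
(* In dimension 0 both properties fail, as a successor is never 0; in dimension 1 both hold. Above
   that, pointedness gives salience and both amount to linearity of [mid]. *)
have [C0|[C1|C2]] : adim C = 0%N \/ adim C = 1%N \/ (1 < adim C)%N.
  by case: (adim C) => [|[|n]]; [left|right; left|right; right].
- split=> [fbi|[S [[dS _] _]]]; last by rewrite C0 in dS.
  have [x /fbi] := relint_nonempty HC affC dirC.
  by rewrite C0.
- split=> _; last exact: FBI_adim1 HC clC affC dirC C1.
  exact: (ellipsoidal_adim1 ptC C1).
have sal := pointed_salient HC dirC ptC C2.
rewrite (adim_cone dirC) in C2.
have W0 : (0 < \dim W)%N by exact: ltnW.
rewrite (FBI_mid HC clC affC dirC sal W0); split.
  exact: mid_ellipsoidal.
exact: ellipsoidal_mid.
Qed.
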